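(* Let $n\ge2$. For any subgroup $G\subset F_n$ and any $\mathbf r\in\mathcal R$, the bottom of the spectrum $\lambda_0^G(\mathbf p_*(\mathbf r,\delta_G(\mathbf r)))$ of the Laplacian $\Delta_{\mathbf p_*(\mathbf r,\delta_G(\mathbf r))}$ on the quotient graph $G\backslash\mathrm{Cay}(F_n)$ is given by \[ \lambda_0^G(\mathbf p_*(\mathbf r,\delta_G(\mathbf r)))=\begin{cases}\lambda\circ H(\mathbf r,\delta_G(\mathbf r)) & \text{if }\delta_G(\mathbf r)>\delta(\mathbf r)/2,\\ \lambda\circ H(\mathbf r,\delta(\mathbf r)/2) & \text{if }\delta_G(\mathbf r)\le\delta(\mathbf r)/2.\end{cases} \]
   Context: $F_n=\langle a_1,\ldots,a_n\rangle$ is the free group of rank $n\ge2$ and $\mathrm{Cay}(F_n)$ its Cayley graph (the $2n$-regular tree with vertex set $F_n$, where $x$ is adjacent to $xa_i^{\pm1}$). A subgroup $G\subset F_n$ acts on $\mathrm{Cay}(F_n)$ by left multiplication; the quotient graph $G\backslash\mathrm{Cay}(F_n)$ has as vertices the cosets $Gx$, on which right multiplication by $a_i^{\pm1}$ is well defined. $\mathcal R=\{\mathbf r=(r_1,\ldots,r_n)\mid r_1+\cdots+r_n=1/2,\ r_i>0\ \forall i\}$ and $\mathcal P=\{\mathbf p=(p_1,\ldots,p_n)\mid p_1+\cdots+p_n=1/2,\ p_i>0\ \forall i\}$. For $\mathbf r\in\mathcal R$, $d_{\mathbf r}$ is the path metric on $\mathrm{Cay}(F_n)$ in which each edge $\{x,xa_i^{\pm1}\}$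 has length $-\log r_i$. For a subgroup $G\subset F_n$, \[ \delta_G(\mathbf r)=\limsup_{R\to\infty}\frac{\log\#\{g\in G\mid d_{\mathbf r}(\mathrm{id},g)\le R\}}{R},\qquad \delta(\mathbf r)=\delta_{F_n}(\mathbf r). \] For $\mathbf p\in\mathcal P$, $\Delta_{\mathbf p}=I-A_{\mathbf p}$ where $(A_{\mathbf p}f)(x)=\sum_{i=1}^n p_i\,(f(xa_i)+f(xa_i^{-1}))$ for functions $f$ on the vertex set of $G\backslash\mathrm{Cay}(F_n)$; it acts as a bounded symmetric operator on $L^2(G\backslash\mathrm{Cay}(F_n))$ (vertex set with counting measure). $\lambda_0^G(\mathbf p)$ is the bottom of its spectrum, $\lambda_0^G(\mathbf p)=\inf\{\langle\Delta_{\mathbf p}f,f\rangle\mid\langle f,f\rangle=1\}$. $H:\mathcal R\times(0,\infty)\to(0,1)^n$ is the diffeomorphism $H(\mathbf r,s)=(r_1^s,\ldots,r_n^s)$. For $\mathbf u\in(0,1)^n$ put $D(\mathbf u)=\sum_j\prod_{k\neq j}(u_k^{-1}-u_k)>0$, $\mathbf p(\mathbf u)=(p_1(\mathbf u),\ldots,p_n(\mathbf u))$ with $p_i(\mathbf u)=\dfrac{\prod_{k\ne i}(u_k^{-1}-u_k)}{2D(\mathbf u)}$, and \[ \lambda(\mathbf u)=D(\mathbf u)^{-1}\Bigl(\sum_{j}(1-u_j)\prod_{k\ne j}(u_k^{-1}-u_k)-\tfrac12\prod_{\ell}(u_\ell^{-1}-u_\ell)\Bigr). \] The weight $\mathbf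 p_*(\mathbf r,s)\in\mathcal P$ is defined for $\mathbf r\in\mathcal R$, $s\ge0$ by $\mathbf p_*(\mathbf r,s)=\mathbf p\circ H(\mathbf r,s)$ if $s>\delta(\mathbf r)/2$ and $\mathbf p_*(\mathbf r,s)=\mathbf p\circ H(\mathbf r,\delta(\mathbf r)/2)$ if $s\le\delta(\mathbf r)/2$. *)

(* Defs.v *)
From HB Require Import structures.
From mathcomp Require Import all_boot all_order all_algebra finmap.
From mathcomp Require Import all_classical all_reals all_analysis.
Set Implicit Arguments.
Unset Strict Implicit.
Unset Printing Implicit Defensive.
Import Order.TTheory GRing.Theory Num.Theory.
Import numFieldNormedType.Exports.
Local Open Scope classical_set_scope.
Local Open Scope ring_scope.

(* The letter (i, true) stands for a_i and (i, false) for its inverse. *)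
Notation letter n := ('I_n * bool)%type.

Definition letter_inv n (l : letter n) : letter n := (l.1, ~~ l.2).

Definition reduced n (w : seq (letter n)) : bool :=
  sorted (fun l m => m != letter_inv l) w.

Record free_group (n : nat) :=
  FreeGroup { fg_word :> seq (letter n); _ : reduced fg_word }.
HB.instance Definition _ n := [isSub for @fg_word n].
HB.instance Definition _ n := [Countable of free_group n by <:].

Section FreeGroupLaws.
Variable n : nat.
Implicit Types (l : letter n) (u v w : seq (letter n)) (x y z : free_group n).

Lemma letter_invK : involutive (@letter_inv n).
Proof. by case=> i b; rewrite /letter_inv negbK. Qed.

(* Prepends l to a reduced word, cancelling it against the first letter if
   possible; fg_mul iterates this, so that products stay reduced. *)
Definition push l w : seq (letter n) :=
  if w is m :: w' then if m == letter_inv l then w' else l :: w else [:: l].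

Lemma push_reduced l w : reduced w -> reduced (push l w).
Proof.
case: w => //= m w mw; case: ifPn => [_|ml]; first exact: path_sorted mw.
by rewrite /reduced /= ml.
Qed.

Lemma pushK l w : reduced w -> push (letter_inv l) (push l w) = w.
Proof.
case: w => [_|m w mw] /=; first by rewrite letter_invK eqxx.
case: ifPn => [/eqP ml|_] /=; last by rewrite letter_invK eqxx.
case: w mw => [_|k w] /=; first by rewrite ml.
by rewrite /reduced /= ml letter_invK => /andP[/negbTE ->].
Qed.

Lemma foldr_push_reduced u w : reduced w -> reduced (foldr push w u).
Proof. by move=> rw; elim: u => //= l u; exact: push_reduced. Qed.

Lemma foldr_push_push l v w : reduced v -> reduced w ->
  foldr push w (push l v) = push l (foldr push w v).
Proof.
case: v => [|m v] //= rv rw; case: ifPn => //= /eqP ->.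
by rewrite -[in LHS](pushK (letter_inv l) (foldr_push_reduced v rw)) letter_invK.
Qed.

Lemma foldr_pushA u v w : reduced v -> reduced w ->
  foldr push w (foldr push v u) = foldr push (foldr push w v) u.
Proof.
move=> rv rw; elim: u => //= l u <-.
by rewrite foldr_push_push// foldr_push_reduced.
Qed.

Lemma foldr_push_nil u : reduced u -> foldr push [::] u = u.
Proof.
elim: u => //= l u IH lu; rewrite IH; last exact: path_sorted lu.
by case: u lu {IH} => //= m u /andP[/negbTE ->].
Qed.

Definition word_inv u : seq (letter n) := rev (map (@letter_inv n) u).

Lemma word_invK : involutive word_inv.
Proof. by move=> u; rewrite /word_inv map_rev revK mapK//; exact: letter_invK. Qed.

Lemma word_inv_reduced u : reduced u -> reduced (word_inv u).
Proof.
rewrite /reduced /word_inv rev_sorted sorted_map.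
apply: sub_sorted => l m /=; apply: contra_neq => /(congr1 (@letter_inv n)).
by rewrite !letter_invK => ->; rewrite letter_invK.
Qed.

Lemma foldr_push_inv u : foldr push u (word_inv u) = [::].
Proof.
elim: u => // l u IH; rewrite /word_inv /= rev_cons foldr_rcons /=.
by rewrite letter_invK eqxx.
Qed.

Lemma fg_reduced x : reduced x. Proof. exact: valP. Qed.

Definition fg_one : free_group n := @FreeGroup n [::] isT.
Definition fg_mul x y : free_group n :=
  FreeGroup (foldr_push_reduced x (fg_reduced y)).
Definition fg_inv x : free_group n := FreeGroup (word_inv_reduced (fg_reduced x)).

Lemma fg_mulA : associative fg_mul.
Proof.
by move=> x y z; apply: val_inj => /=; rewrite foldr_pushA// fg_reduced.
Qed.
Lemma fg_mul1g : left_id fg_one fg_mul.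
Proof. by move=> x; exact: val_inj. Qed.
Lemma fg_mulg1 : right_id fg_one fg_mul.
Proof. by move=> x; apply: val_inj; rewrite /= foldr_push_nil// fg_reduced. Qed.
Lemma fg_mulVg : left_inverse fg_one fg_inv fg_mul.
Proof. by move=> x; apply: val_inj; exact: foldr_push_inv. Qed.
Lemma fg_mulgV : right_inverse fg_one fg_inv fg_mul.
Proof.
by move=> x; apply: val_inj; rewrite /= -{2}(word_invK x) foldr_push_inv.
Qed.

End FreeGroupLaws.

HB.instance Definition _ n := isGroup.Build (free_group n)
  (@fg_mulA n) (@fg_mul1g n) (@fg_mulg1 n) (@fg_mulVg n) (@fg_mulgV n).

Definition fg_letter n (l : letter n) : free_group n :=
  @FreeGroup n [:: l] isT.

Definition fg_gen n (i : 'I_n) : free_group n := fg_letter (i, true).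

Lemma fg_letterV n (l : letter n) : fg_letter (letter_inv l) = ((fg_letter l)^-1)%g.
Proof. exact: val_inj. Qed.

(* The parameter sets of r and of p are the same simplex. *)
Definition weights (R : realType) n : set ('I_n -> R) :=
  [set r | \sum_i r i = 2^-1 /\ forall i, 0 < r i].

(* An edge path of the Cayley graph issued from x is the word of the letters
   that label its successive edges, not necessarily reduced. *)
Definition path_end n (x : free_group n) (w : seq (letter n)) : free_group n :=
  foldl (fun y l => (y * fg_letter l)%g) x w.

Definition path_length (R : realType) n (r : 'I_n -> R) (w : seq (letter n)) : R :=
  \sum_(l <- w) - ln (r l.1).

Definition cayley_dist (R : realType) n (r : 'I_n -> R) (x y : free_group n) : R :=
  inf [set path_length r w | w in [set w | path_end x w = y]].

(* The balls below are finite when the r i lie in ]0, 1[, so that fset_set gives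
   the true cardinality, and the limsup is then a real number. *)
Definition orbit_count (R : realType) n (G : set (free_group n)) (r : 'I_n -> R)
    (t : R) : nat :=
  #|` fset_set [set g | G g /\ cayley_dist r 1%g g <= t]|.

Definition critical_exponent (R : realType) n (G : set (free_group n))
    (r : 'I_n -> R) : R :=
  fine (limf_esup (fun t : R => (ln (orbit_count G r t)%:R / t)%:E) +oo%R).

Definition coset_set n (G : set (free_group n)) (x : free_group n) :
    set (free_group n) :=
  [set (g * x)%g | g in G].

Definition quotient_vertex n (G : set (free_group n)) : Type :=
  {C : set (free_group n) | C \in range (coset_set G)}.
HB.instance Definition _ n (G : set (free_group n)) :=
  Choice.on (quotient_vertex G).

Lemma vertex_mul_subproof n (G : set (free_group n)) (C : quotient_vertex G)
    (a : free_group n) :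
  [set (c * a)%g | c in val C] \in range (coset_set G).
Proof.
case: C => C /= /set_mem[x _ <-]; apply/mem_set; exists (x * a)%g => //.
by rewrite /coset_set image_comp; apply: eq_imagel => g _ /=; rewrite mulgA.
Qed.

Definition vertex_mul n (G : set (free_group n)) (C : quotient_vertex G)
    (a : free_group n) : quotient_vertex G :=
  exist (fun C => C \in range (coset_set G)) _ (vertex_mul_subproof C a).

Definition averaging (R : realType) n (G : set (free_group n)) (p : 'I_n -> R)
    (f : quotient_vertex G -> R) : quotient_vertex G -> R :=
  fun C => \sum_i p i * (f (vertex_mul C (fg_gen i)) +
                         f (vertex_mul C (fg_gen i)^-1%g)).

Definition laplacian (R : realType) n (G : set (free_group n)) (p : 'I_n -> R)
    (f : quotient_vertex G -> R) : quotient_vertex G -> R :=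
  f \- averaging p f.

Definition square_summable (R : realType) (V : choiceType) (f : V -> R) : Prop :=
  summable setT (fun x => (f x ^+ 2)%:E).

(* The sum of f x * g x over all x, computed as the sum of the positive parts
   minus the sum of the negative parts; it converges absolutely when f and g are
   square summable. Real-valued f give the same bottom of the spectrum as
   complex-valued ones, since the Laplacian has real coefficients. *)
Definition l2_dot (R : realType) (V : choiceType) (f g : V -> R) : R :=
  let h := fun x => (f x * g x)%:E in
  fine (\esum_(x in setT) h^\+%E x - \esum_(x in setT) h^\-%E x)%E.

Definition bottom_spectrum (R : realType) n (G : set (free_group n))
    (p : 'I_n -> R) : R :=
  inf [set l2_dot (laplacian p f) f |
       f in [set f : quotient_vertex G -> R |
             square_summable f /\ l2_dot f f = 1]].

Definition H_map (R : realType) n (r : 'I_n -> R) (s : R) : 'I_n -> R :=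
  fun i => r i `^ s.

Definition D_fun (R : realType) n (u : 'I_n -> R) : R :=
  \sum_j \prod_(k | k != j) ((u k)^-1 - u k).

Definition p_fun (R : realType) n (u : 'I_n -> R) : 'I_n -> R :=
  fun i => (\prod_(k | k != i) ((u k)^-1 - u k)) / (2 * D_fun u).

Definition lambda_fun (R : realType) n (u : 'I_n -> R) : R :=
  (D_fun u)^-1 *
  (\sum_j (1 - u j) * \prod_(k | k != j) ((u k)^-1 - u k)
   - 2^-1 * \prod_l ((u l)^-1 - u l)).

Definition p_star (R : realType) n (r : 'I_n -> R) (s : R) : 'I_n -> R :=
  let delta := critical_exponent setT r in
  if delta / 2 < s then p_fun (H_map r s) else p_fun (H_map r (delta / 2)).

(* Main.v *)
Require Import Defs.
From mathcomp Require Import all_boot all_order all_algebra.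
From mathcomp Require Import all_classical all_reals all_analysis.
From mathcomp Require Import finmap ring lra.
Set Implicit Arguments.
Unset Strict Implicit.
Unset Printing Implicit Defensive.
Local Open Scope ring_scope.
Import Order.TTheory GRing.Theory Num.Theory.
Import numFieldNormedType.Exports.
Local Open Scope classical_set_scope.

(** Write [u = H(r, s)] and [p = p(u)].  On the tree, [phi(x) = exp (- s d(1, x))]
    satisfies [A phi + c delta_1 = (1 - lambda(u)) phi]: up to the constant [c] it
    is the Green function of [Delta - lambda(u)] as soon as it is square summable,
    i.e. when [s > delta(r) / 2].

    Lower bound: for [s > delta_G] the sum of [phi] over a coset is a positive
    supersolution on the quotient, so Barta's principle bounds the spectrum from
    below by [lambda(u)]; continuity in [p] reaches [s = delta_G].

    Upper bound: if the bottom of the spectrum exceeded [lambda(u)], the same would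
    hold uniformly for all [s] close to the given one.  The partial sums of the
    Neumann series of the Green function of the quotient, which are push-forwards
    of those of the tree, would then be bounded in [l^2].  For [s] slightly below
    [delta_G > delta(r) / 2] this bounds the sum of [phi] over [G], contradicting
    the definition of [delta_G]; for [s] slightly above [delta(r) / 2] it bounds
    the sum of [phi^2] over the tree, contradicting the divergence of the Poincare
    series of the free group at [delta(r)].  The latter holds because summability
    of [phi] is equivalent to [lambda(u) < 0], an open condition on [s]. *)

(** * Limits of finite sums and punctual neighbourhoods on the real line *)

Lemma cvg_sum_seq (R : realType) (T I : Type) (F : set_system T)
    (FF : Filter F) (s : seq I) (f : I -> T -> R) (l : I -> R) :
  (forall i, f i x @[x --> F] --> l i) ->
  \sum_(i <- s) f i x @[x --> F] --> \sum_(i <- s) l i.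
Proof.
move=> fl; elim: s => [|i s IH].
  by under eq_fun do rewrite big_nil; rewrite big_nil; exact: cvg_cst.
by under eq_fun do rewrite big_cons; rewrite big_cons; exact: cvgD.
Qed.

Lemma near_ball (R : realType) (P : R -> Prop) (s0 : R) : (\forall s \near s0, P s) ->
  exists2 e, 0 < e & forall s, `|s0 - s| < e -> P s.
Proof. by move=> /nbhs_ballP[e /= e0 eP]; exists e => // s se; exact: eP. Qed.

(** * Sums of nonnegative functions *)

Section Tsum.
Variables (R : realType) (V : choiceType).
Implicit Types (f g : V -> R).

(** Values in [\bar R] let nonnegative sums be split, scaled and reindexed before anything is known
    to converge; [summ] records finiteness where it matters. *)
Definition tsum f : \bar R := \esum_(x in [set: V]) (f x)%:E.

Lemma tsum_ge0 f : (forall x, 0 <= f x) -> (0 <= tsum f)%E.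
Proof. by move=> f0; apply: esum_ge0 => x _; rewrite lee_fin. Qed.

Lemma tsum_le f g : (forall x, f x <= g x) -> (tsum f <= tsum g)%E.
Proof. by move=> fg; apply: le_esum => x _; rewrite lee_fin. Qed.

Lemma tsumD f g : (forall x, 0 <= f x) -> (forall x, 0 <= g x) ->
  tsum (fun x => f x + g x) = (tsum f + tsum g)%E.
Proof.
by move=> f0 g0; rewrite /tsum -esumD// => x _; rewrite lee_fin.
Qed.

Lemma tsum_sum (I : Type) (s : seq I) (F : I -> V -> R) :
  (forall i x, 0 <= F i x) ->
  tsum (fun x => \sum_(i <- s) F i x) = (\sum_(i <- s) tsum (F i))%E.
Proof.
move=> F0; elim: s => [|i s IH].
  rewrite big_nil /tsum; apply: esum1 => x _; by rewrite big_nil.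
rewrite big_cons -IH -tsumD//; last by move=> x; exact: sumr_ge0.
by congr tsum; apply/funext => x; rewrite big_cons.
Qed.

Lemma tsumZ (c : R) f : 0 <= c -> (forall x, 0 <= f x) ->
  tsum (fun x => c * f x) = (c%:E * tsum f)%E.
Proof.
move=> c0 f0; have le_tsumZ (d : R) h : 0 <= d -> (forall x, 0 <= h x) ->
    (tsum (fun x => d * h x)%R <= d%:E * tsum h)%E.
  move=> d0 h0; apply: ge_ereal_sup => _ [X [finX _] <-].
  under eq_fsbigr do rewrite EFinM.
  rewrite -ge0_mule_fsumr; last by move=> x; rewrite lee_fin.
  by rewrite lee_wpmul2l ?lee_fin//; apply: ereal_sup_ubound; exists X.
apply/eqP; rewrite eq_le le_tsumZ//=.
have [->|cn0] := eqVneq c 0.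
  by rewrite mul0e tsum_ge0// => x; rewrite mul0r.
have {cn0}c0 : 0 < c by rewrite lt_neqAle eq_sym cn0.
have ci0 : 0 <= c^-1 by rewrite invr_ge0 ltW.
have cf0 x : 0 <= c * f x by rewrite mulr_ge0// ltW.
(* The converse is the same inequality for [c^-1] and [c * f]. *)
have := le_tsumZ c^-1 _ ci0 cf0; under eq_fun do rewrite mulKf ?gt_eqF//.
move=> /(lee_wpmul2l (_ : (0 <= c%:E)%E)); rewrite lee_fin => /(_ (ltW c0)).
by rewrite muleA -EFinM mulfV ?gt_eqF// mul1e.
Qed.

Lemma tsum_reindex (s s' : V -> V) f : cancel s s' -> cancel s' s ->
  tsum (f \o s) = tsum f.
Proof.
move=> sK s'K; rewrite /tsum [RHS](reindex_esum [set: V] [set: V] s)//.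
by rewrite setTT_bijective; exists s'.
Qed.

Lemma tsum_point f (x : V) : (forall x, 0 <= f x) -> ((f x)%:E <= tsum f)%E.
Proof.
move=> f0; apply: esum_ge; exists [set x]; first by split.
by rewrite fsbig_set1.
Qed.

Lemma tsum_fset f (X : {fset V}) : (forall x, 0 <= f x) ->
  ((\sum_(x <- X) f x)%:E <= tsum f)%E.
Proof.
move=> f0; apply: esum_ge; exists [set` X]; first by split.
by rewrite fsbig_finite// set_fsetK sumEFin.
Qed.

Lemma tsum_fset_le f (M : R) :
  (forall X : {fset V}, \sum_(x <- X) f x <= M) -> (tsum f <= M%:E)%E.
Proof.
move=> fM; apply: ge_ereal_sup => _ [X [finX _] <-].
by rewrite fsbig_finite//= sumEFin lee_fin.
Qed.

Lemma tsum_delta (x : V) (c : R) : 0 <= c ->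
  tsum (fun y => c *+ (y == x)) = c%:E.
Proof.
move=> c0; rewrite /tsum -(@esum_set1 _ _ x (fun=> c%:E)) ?lee_fin//.
rewrite [RHS]esum_mkcond; apply: eq_esum => y _.
have [->|yx] := eqVneq y x; first by rewrite mem_set.
by rewrite memNset//; exact/eqP.
Qed.

Definition summ f := (tsum f < +oo)%E.

Lemma summ_fin f : (forall x, 0 <= f x) -> summ f -> tsum f \is a fin_num.
Proof. by move=> f0 sf; rewrite ge0_fin_numE// tsum_ge0. Qed.

Lemma summ_le f g : (forall x, f x <= g x) -> summ g -> summ f.
Proof. by move=> fg; apply: le_lt_trans; exact: tsum_le. Qed.

Lemma summD f g : (forall x, 0 <= f x) -> (forall x, 0 <= g x) ->
  summ f -> summ g -> summ (fun x => f x + g x).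
Proof. by move=> f0 g0 sf sg; rewrite /summ tsumD// lte_add_pinfty. Qed.

Lemma summZ c f : 0 <= c -> (forall x, 0 <= f x) -> summ f ->
  summ (fun x => c * f x).
Proof.
move=> c0 f0 sf; rewrite /summ tsumZ// -(fineK (summ_fin f0 sf)).
by rewrite -EFinM ltry.
Qed.

End Tsum.

(** * Averaging operators, Dirichlet forms and Green functions *)

Section Averaging.
Variables (R : realType) (n : nat) (V : choiceType).
Variable step : letter n -> V -> V.
Hypothesis stepK : forall l, cancel (step l) (step (letter_inv l)).
Implicit Types (p : 'I_n -> R) (f g : V -> R).

Lemma stepVK l : cancel (step (letter_inv l)) (step l).
Proof. by move=> x; have := stepK (letter_inv l) x; rewrite letter_invK. Qed.

(** [step] is abstract so that the tree and the quotient share this section. A letter and its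
    inverse carry the same weight, which makes the operator symmetric. *)
Definition avg p f (x : V) : R := \sum_(l : letter n) p l.1 * f (step l x).

(** The Dirichlet form; the factor 1/2 compensates for seeing each edge from both ends. *)
Definition energy p f : \bar R :=
  tsum (fun x => \sum_(l : letter n) p l.1 / 2 * (f x - f (step l x)) ^+ 2).

Lemma avg_ge0 p f : (forall i, 0 <= p i) -> (forall x, 0 <= f x) ->
  forall x, 0 <= avg p f x.
Proof. by move=> p0 f0 x; apply: sumr_ge0 => l _; rewrite mulr_ge0. Qed.

Lemma sum_letters p : \sum_(l : letter n) p l.1 = 2 * \sum_i p i.
Proof.
rewrite -(pair_big xpredT xpredT (fun i (_ : bool) => p i))/=.
by rewrite mulr_sumr; apply: eq_bigr => i _; rewrite big_bool mulr2n mulrDl mul1r.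
Qed.

(** Symmetry of the averaging operator: moving [x] along [l] turns the term of [l] into that of its
    inverse. *)
Lemma tsum_avgM p f g : (forall i, 0 <= p i) ->
  (forall x, 0 <= f x) -> (forall x, 0 <= g x) ->
  tsum (fun x => avg p f x * g x) = tsum (fun x => f x * avg p g x).
Proof.
move=> p0 f0 g0.
transitivity (\sum_(l : letter n)
  (p l.1)%:E * tsum (fun x => f (step l x) * g x)%R)%E.
  under eq_fun do rewrite /avg mulr_suml.
  rewrite tsum_sum => [|l x]; last by rewrite !mulr_ge0.
  apply: eq_bigr => l _; rewrite -tsumZ//; last by move=> x; rewrite mulr_ge0.
  by under eq_fun do rewrite -mulrA.
transitivity (\sum_(l : letter n)
  (p l.1)%:E * tsum (fun x => f x * g (step l x))%R)%E; last first.
  under [in RHS]eq_fun do rewrite /avg mulr_sumr.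
  rewrite tsum_sum => [|l x]; last by rewrite !mulr_ge0.
  apply: eq_bigr => l _; rewrite -tsumZ//; last by move=> x; rewrite mulr_ge0.
  by under eq_fun do rewrite mulrCA.
rewrite (reindex_inj (inv_inj (@letter_invK n)))/=; apply: eq_bigr => l _.
congr (_ * _)%E; rewrite -(tsum_reindex _ (stepK l) (stepVK l)).
by congr tsum; apply/funext => x /=; rewrite stepK.
Qed.

(** Symmetry tested against the constant function 1. *)
Lemma tsum_avg p f : (forall i, 0 <= p i) -> (forall x, 0 <= f x) ->
  tsum (avg p f) = ((2 * \sum_i p i)%:E * tsum f)%E.
Proof.
move=> p0 f0; have := tsum_avgM p0 f0 (fun _ => ler01).
under eq_fun do rewrite mulr1.
move=> ->; under eq_fun do rewrite mulrC.
rewrite -tsumZ ?mulr_ge0 ?sumr_ge0//; congr tsum; apply/funext => x.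
by rewrite /avg -sum_letters; under eq_bigr do rewrite mulr1.
Qed.

Lemma energy_termE p f x : \sum_i p i = 2^-1 ->
  \sum_(l : letter n) p l.1 / 2 * (f x - f (step l x)) ^+ 2 =
  2^-1 * f x ^+ 2 + 2^-1 * avg p (fun x => f x ^+ 2) x - avg p f x * f x.
Proof.
move=> p1.
have E : 2^-1 * f x ^+ 2 = \sum_(l : letter n) p l.1 * (2^-1 * f x ^+ 2).
  by rewrite -mulr_suml sum_letters p1; field.
rewrite E /avg mulr_sumr mulr_suml -big_split -sumrB/=.
by apply: eq_bigr => l _; field.
Qed.

Lemma energy_term_ge0 p f x : (forall i, 0 <= p i) ->
  0 <= \sum_(l : letter n) p l.1 / 2 * (f x - f (step l x)) ^+ 2.
Proof.
by move=> p0; apply: sumr_ge0 => l _; rewrite mulr_ge0 ?sqr_ge0// mulr_ge0.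
Qed.

Lemma energy_ge0 p f : (forall i, 0 <= p i) -> (0 <= energy p f)%E.
Proof. by move=> p0; apply: tsum_ge0 => x; exact: energy_term_ge0. Qed.

(** On each edge [(a - b)^2 <= 2 a^2 + 2 b^2]. The weights are not normalised, because the bound is
    also applied to [|p - q|]. *)
Lemma energy_le p f : (forall i, 0 <= p i) ->
  (energy p f <= (4 * \sum_i p i)%:E * tsum (fun x => f x ^+ 2)%R)%E.
Proof.
move=> p0; have f20 x : 0 <= f x ^+ 2 by exact: sqr_ge0.
have P0 : 0 <= 2 * \sum_i p i by rewrite mulr_ge0// sumr_ge0.
apply: (@le_trans _ _ (tsum (fun x => (2 * \sum_i p i) * f x ^+ 2 +
  avg p (fun x => f x ^+ 2) x)%R)).
  apply: tsum_le => x; rewrite -sum_letters mulr_suml /avg -big_split/=.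
  apply: ler_sum => l _; have := sqr_ge0 (f x + f (step l x)).
  have := p0 l.1; move: (f x) (f (step l x)) (p l.1) => a b c c0 ab0.
  rewrite -subr_ge0.
  rewrite (_ : _ - _ = c / 2 * (a + b) ^+ 2); last by field.
  by rewrite mulr_ge0// divr_ge0.
rewrite tsumD//; last exact: avg_ge0.
  rewrite tsumZ// tsum_avg// -ge0_muleDl ?lee_fin// -EFinD.
  by rewrite (_ : _ + _ = 4 * \sum_i p i) //; lra.
by move=> x; rewrite mulr_ge0.
Qed.

Lemma energyD p q f : (forall i, 0 <= p i) -> (forall i, 0 <= q i) ->
  energy (fun i => p i + q i) f = (energy p f + energy q f)%E.
Proof.
move=> p0 q0; rewrite /energy -tsumD; try by move=> x; exact: energy_term_ge0.
congr tsum; apply/funext => x; rewrite -big_split/=; apply: eq_bigr => l _.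
by rewrite -mulrDl -mulrDl.
Qed.

Lemma energy_le_weights p q f : (forall i, p i <= q i) ->
  (energy p f <= energy q f)%E.
Proof.
move=> pq; apply: tsum_le => x; apply: ler_sum => l _.
by rewrite ler_wpM2r ?sqr_ge0// ler_pM2r ?invr_gt0.
Qed.

(* For a weight [p] this says that [mu] is at most the bottom of the spectrum. *)
Definition gap p (mu : R) := forall f, summ (fun x => f x ^+ 2) ->
  (mu%:E * tsum (fun x => f x ^+ 2)%R <= energy p f)%E.

(** Since [p <= q + |p - q|], the form of [p] exceeds that of [q] by at most the form of [|p - q|],
    which [energy_le] bounds. *)
Lemma gap_perturb p q mu : (forall i, 0 <= p i) -> (forall i, 0 <= q i) ->
  gap p mu -> gap q (mu - 4 * \sum_i `|p i - q i|).
Proof.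
move=> p0 q0 gp f sf; have f20 x : 0 <= f x ^+ 2 by exact: sqr_ge0.
have S := fineK (summ_fin f20 sf); move: (gp f sf) (energy_ge0 f q0) (energy_le f q0).
have d0 i : 0 <= `|p i - q i| by [].
have := energy_le f d0.
have : (energy p f <= energy q f + energy (fun i => `|p i - q i|)%R f)%E.
  rewrite -energyD//; apply: energy_le_weights => i.
  by have := ler_norm (p i - q i); lra.
rewrite -S; move: (fine _) (energy _ _) (energy _ _) (energy _ _) => s.
move=> [a| |] [b| |] [c| |]; rewrite -?EFinD -?EFinM ?lee_fin ?ltey_eq//=.
by rewrite ?lee_fin; lra.
Qed.

Lemma gap_le p (mu nu : R) :
  nu <= mu -> gap p mu -> gap p nu.
Proof.
move=> numu gp f sf; apply: le_trans (gp f sf).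
by apply: lee_wpmul2r; rewrite ?lee_fin// tsum_ge0// => x; exact: sqr_ge0.
Qed.

Lemma gap_closed p (mu : R) :
  (forall e, 0 < e -> gap p (mu - e)) -> gap p mu.
Proof.
move=> gp f sf; have f20 x : 0 <= f x ^+ 2 by exact: sqr_ge0.
have S := fineK (summ_fin f20 sf).
have s0 : 0 <= fine (tsum (fun x => f x ^+ 2)) by rewrite -lee_fin S tsum_ge0.
apply/lee_addgt0Pr => e e0; rewrite -S -EFinM.
(* The [+ 1] allows for [s = 0]. *)
set s := fine _ in s0 *; have s1 : 0 < s + 1 by rewrite ltr_wpDl.
have d0 : 0 < e / (s + 1) by rewrite divr_gt0.
have := gp _ d0 f sf; rewrite -S -/s -EFinM.
case: (energy _ _) => [a| |]; rewrite ?leey// -?EFinD ?lee_fin//.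
move=> h; apply: le_trans (_ : (mu - e / (s + 1)) * s + e <= _); last by rewrite lerD2r.
rewrite mulrBl -addrA lerDl addrC subr_ge0 mulrAC ler_pdivrMr//.
by rewrite ler_pM2l// lerDl.
Qed.

(** The form is [<f, f> - <A f, f>], written additively so that no infinite value is subtracted. *)
Lemma energy_avg p f : (forall i, 0 <= p i) -> \sum_i p i = 2^-1 ->
  (forall x, 0 <= f x) -> 
  (energy p f + tsum (fun x => avg p f x * f x)%R = tsum (fun x => f x ^+ 2)%R)%E.
Proof.
move=> p0 p1 f0; have f20 x : 0 <= f x ^+ 2 by exact: sqr_ge0.
rewrite /energy -tsumD; last first.
- by move=> x; rewrite mulr_ge0// avg_ge0.
- by move=> x; exact: energy_term_ge0.
under eq_fun do rewrite energy_termE// subrK.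
rewrite tsumD; last first.
- by move=> x; rewrite mulr_ge0// avg_ge0.
- by move=> x; rewrite mulr_ge0.
rewrite !tsumZ//; last exact: avg_ge0.
rewrite tsum_avg// p1 mulfV// mul1e -ge0_muleDl ?lee_fin//.
by rewrite -EFinD (_ : _ + _ = 1) ?mul1e//; field.
Qed.

(* Barta's principle: a positive supersolution bounds the Dirichlet form from
   below, by AM-GM on each edge with weights given by the supersolution. *)
Lemma gap_supersolution p kappa (F : V -> R) :
  (forall i, 0 <= p i) -> \sum_i p i = 2^-1 ->
  (forall x, 0 < F x) -> (forall x, avg p F x <= kappa * F x) ->
  gap p (1 - kappa).
Proof.
move=> p0 p1 F0 AF f sf.
have f20 x : 0 <= f x ^+ 2 by exact: sqr_ge0.
(* For an edge from [x] to [y], AM-GM reads [2 f(x) f(y) <= f(x)^2 F(y) / F(x) + f(y)^2 F(x) /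
   F(y)]. [H] collects the first terms, [H'] the second ones, and both have the same total. *)
pose h l x := f x ^+ 2 * (F (step l x) / F x).
have h0 l x : 0 <= h l x by rewrite mulr_ge0// divr_ge0// ltW.
have ph0 l x : 0 <= p l.1 * h l x by rewrite mulr_ge0.
pose H x := \sum_(l : letter n) p l.1 * h l x.
have H0 x : 0 <= H x by apply: sumr_ge0.
pose H' x := \sum_(l : letter n) p l.1 * h (letter_inv l) (step l x).
have H'0 x : 0 <= H' x by apply: sumr_ge0 => l _; rewrite mulr_ge0.
have HH' : tsum H' = tsum H.
  rewrite /H' /H !tsum_sum//; last by move=> l x; rewrite mulr_ge0.
  rewrite [RHS](reindex_inj (inv_inj (@letter_invK n)))/=.
  apply: eq_bigr => l _; rewrite !tsumZ//; congr (_ * _)%E.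
  exact: (tsum_reindex (h (letter_inv l)) (stepK l) (stepVK l)).
have HE x : H x = f x ^+ 2 / F x * avg p F x.
  rewrite /H /avg mulr_sumr; apply: eq_bigr => l _; rewrite /h; ring.
have Hle x : H x <= kappa * f x ^+ 2.
  rewrite HE -mulrA [X in _ <= X]mulrC ler_wpM2l// mulrC ler_pdivrMr//.
have main : (tsum (fun x => f x ^+ 2)%R <= energy p f + tsum H)%E.
  have h2 : (0 : R) <= 2^-1 by rewrite invr_ge0.
  have e1 : (tsum H = 2^-1%:E * tsum H + 2^-1%:E * tsum H')%E.
    by rewrite HH' -ge0_muleDl ?lee_fin// -EFinD (_ : _ + _ = 1) ?mul1e//; field.
  have e2 : (tsum (fun x => f x ^+ 2)%R =
    tsum (fun x => 2^-1 * f x ^+ 2 + 2^-1 * avg p (fun x => f x ^+ 2) x)%R)%E.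
    rewrite tsumD; last first.
    - by move=> x; rewrite mulr_ge0// avg_ge0.
    - by move=> x; rewrite mulr_ge0.
    rewrite !tsumZ//; last exact: avg_ge0.
    rewrite tsum_avg// p1 mulfV// mul1e -ge0_muleDl ?lee_fin//.
    by rewrite -EFinD (_ : _ + _ = 1) ?mul1e//; field.
  rewrite e1 e2 -!tsumZ// -tsumD; try by move=> x; rewrite mulr_ge0.
  rewrite /energy -tsumD; last first.
  - by move=> x; rewrite addr_ge0// mulr_ge0.
  - by move=> x; exact: energy_term_ge0.
  apply: tsum_le => x.
  have -> : 2^-1 * f x ^+ 2 = \sum_(l : letter n) p l.1 * (2^-1 * f x ^+ 2).
    by rewrite -mulr_suml sum_letters p1; field.
  rewrite /avg /H /H' !mulr_sumr -!big_split/=.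
  apply: ler_sum => l _; rewrite /h stepK.
  move: (F0 x) (F0 (step l x)) (p0 l.1).
  move: (f x) (f (step l x)) (F x) (F (step l x)) (p l.1) => a b c d q c0 d0 q0.
  rewrite -subr_ge0.
  (* The slack in AM-GM is a perfect square. *)
  rewrite (_ : _ - _ = q / (2 * (c * d)) * (a * d - b * c) ^+ 2); last first.
    by field; rewrite !gt_eqF.
  by rewrite mulr_ge0 ?sqr_ge0// divr_ge0// mulr_ge0// mulr_ge0// ltW.
(* A vertex is used to get [0 <= kappa]; on an empty [V] all sums vanish. *)
have [[x0 _]|] := pselect (exists x : V, True); last first.
  move=> nV; have T0 : forall g : V -> R, tsum g = 0%E.
    by move=> g; apply: esum1 => x; case: nV; exists x.
  by rewrite /energy !T0 mule0.
have k0 : 0 <= kappa.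
  rewrite -(pmulr_lge0 _ (F0 x0)); apply: le_trans (AF x0).
  by apply: avg_ge0 => // y; exact: ltW.
have : (tsum H <= kappa%:E * tsum (fun x => f x ^+ 2)%R)%E.
  by rewrite -tsumZ//; exact: tsum_le.
move: main (energy_ge0 f p0); have := tsum_ge0 H0.
have S := fineK (summ_fin f20 sf); rewrite -S.
move: (fine _) (energy _ _) (tsum _) => s.
move=> [a| |] [b| |]; rewrite -?EFinD -?EFinM ?lee_fin ?leey//=.
by lra.
Qed.

(** Partial sum of the Neumann series of [(kappa - A)^-1] at the point mass of [o], that is
    [\sum_(k < N) kappa^-(k+1) A^k delta_o]. With [kappa = 1 - lambda] its limit is the Green
    function of [Delta - lambda]. *)
Fixpoint green p kappa (o : V) (N : nat) (x : V) : R :=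
  if N is M.+1 then ((x == o)%:R + avg p (green p kappa o M) x) / kappa else 0.

Section Green.
Variables (p : 'I_n -> R) (kappa : R) (o : V).
Hypotheses (p_ge0 : forall i, 0 <= p i) (kappa_gt0 : 0 < kappa).
Notation g := (green p kappa o).

Lemma green_ge0 N x : 0 <= g N x.
Proof.
elim: N x => //= N IH x; rewrite divr_ge0 ?(ltW kappa_gt0)//.
by rewrite addr_ge0 ?ler0n// avg_ge0.
Qed.

Lemma greenS N x : kappa * g N.+1 x = (x == o)%:R + avg p (g N) x.
Proof. by rewrite /= mulrC divfK// gt_eqF. Qed.

Lemma avg_le f h : (forall x, f x <= h x) -> forall x, avg p f x <= avg p h x.
Proof. by move=> fh x; apply: ler_sum => l _; rewrite ler_wpM2l. Qed.

Lemma green_homo N x : g N x <= g N.+1 x.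
Proof.
elim: N x => [|N IH] x; first exact: green_ge0.
rewrite /= ler_pM2r ?invr_gt0// lerD2l; exact: avg_le.
Qed.

Lemma summ_avg f : (forall x, 0 <= f x) -> summ f -> summ (avg p f).
Proof.
move=> f0 sf; rewrite /summ tsum_avg// -(fineK (summ_fin f0 sf)).
by rewrite -EFinM ltry.
Qed.

Lemma green_summ N : summ (g N).
Proof.
elim: N => [|N IH].
  by rewrite /summ /tsum esum1// ltry.
have -> : g N.+1 = fun x => kappa^-1 * ((x == o)%:R + avg p (g N) x).
  by apply/funext => x; rewrite /= mulrC.
apply: summZ; first by rewrite invr_ge0 ltW.
  move=> x; apply: addr_ge0; first exact: ler0n.
  by apply: avg_ge0 => // ?; exact: green_ge0.
apply: summD => [x|x||]; first exact: ler0n.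
- by rewrite avg_ge0// => ?; exact: green_ge0.
- by rewrite /summ tsum_delta// ltry.
- by apply: summ_avg => //; exact: green_ge0.
Qed.

(** [g N] is bounded by its total mass [M], so its square is at most [M * g N]. This makes [g N] an
    admissible test function for [gap]. *)
Lemma green_summ2 N : summ (fun x => g N x ^+ 2).
Proof.
have := green_summ N; set M := fine (tsum (g N)) => sg.
have ME : tsum (g N) = M%:E by rewrite fineK// summ_fin//; exact: green_ge0.
apply: (@summ_le _ _ _ (fun x => M * g N x)) => [x|].
  rewrite expr2 ler_wpM2r ?green_ge0// -lee_fin -ME.
  by apply: tsum_point; exact: green_ge0.
apply: summZ => //; last exact: green_ge0.
by rewrite -lee_fin -ME; apply: tsum_ge0; exact: green_ge0.
Qed.

(** As [g N <= g N.+1], the recursion gives [kappa |g|^2 <= g(o) + <A g, g>]. With the gap applied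
    to [g = g N] this yields [d |g|^2 <= g(o) <= |g|] for [d = mu - (1 - kappa)], a bound
    independent of [N]. *)
Lemma gap_green_bound mu N : \sum_i p i = 2^-1 -> gap p mu ->
  1 - kappa < mu ->
  (tsum (fun x => g N x ^+ 2)%R <= ((mu - (1 - kappa)) ^- 2)%:E)%E.
Proof.
move=> p1 gp kmu; have g0 := green_ge0 N.
have f20 x : 0 <= g N x ^+ 2 by exact: sqr_ge0.
have S := fineK (summ_fin f20 (green_summ2 N)).
have := gp _ (green_summ2 N).
have := energy_avg p_ge0 p1 g0.
have : ((g N o ^+ 2)%:E <= tsum (fun x => g N x ^+ 2)%R)%E.
  exact: (@tsum_point _ _ (fun x => g N x ^+ 2)).
have : (kappa%:E * tsum (fun x => g N x ^+ 2)%R <=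
        (g N o)%:E + tsum (fun x => avg p (g N) x * g N x)%R)%E.
  rewrite -tsumZ ?(ltW kappa_gt0)// -(@tsum_delta _ _ o (g N o))// -tsumD; last first.
  - by move=> x; rewrite mulr_ge0// avg_ge0.
  - by move=> x; rewrite mulrn_wge0.
  apply: tsum_le => x; rewrite expr2 mulrA.
  apply: (@le_trans _ _ (((x == o)%:R + avg p (g N) x) * g N x)).
    by rewrite -greenS// ler_wpM2r// ler_wpM2l ?(ltW kappa_gt0)// green_homo.
  by rewrite mulrDl lerD2r; case: eqP => [->|_]; rewrite ?mul1r ?mul0r.
have : (0 <= tsum (fun x => avg p (g N) x * g N x)%R)%E.
  by apply: tsum_ge0 => x; rewrite mulr_ge0// avg_ge0.
move: (energy_ge0 (g N) p_ge0).
rewrite -S; move: (fine _) (energy _ _) (tsum _) => s.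
move=> [e| |] [b| |]; rewrite -?EFinD -?EFinM ?lee_fin//=.
move=> e0 b0 h1 h2 [h3] h4.
set d := mu - _; have d0 : 0 < d by rewrite /d; lra.
have s0 : 0 <= s by lra.
have h5 : d * s <= g N o.
  rewrite /d.
  by move: h1 h3 h4; rewrite ?lee_fin; move=> h1 h3 h4; lra.
have h6 : (d * s) ^+ 2 <= s.
  apply: le_trans h2; rewrite ler_pXn2r// nnegrE ?g0// mulr_ge0// ltW//.
rewrite -div1r ler_pdivlMr ?exprn_gt0//.
move: s0; rewrite le_eqVlt => /predU1P[<-|s0]; first by rewrite mul0r.
by rewrite -(ler_pM2l s0) mulr1 (le_trans _ h6)// exprMn; lra.
Qed.

End Green.

End Averaging.

(** * The Cayley tree *)

Definition tree_step n (l : letter n) (x : free_group n) : free_group n :=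
  (x * fg_letter l)%g.

Lemma tree_stepK n (l : letter n) : cancel (tree_step l) (tree_step (letter_inv l)).
Proof. by move=> x; rewrite /tree_step fg_letterV mulgK. Qed.

Lemma path_end_cat_mul n (x : free_group n) w :
  path_end x w = (x * path_end 1 w)%g.
Proof.
rewrite /path_end; elim: w x => [|l w IH] x /=; first by rewrite mulg1.
by rewrite IH [in RHS]IH mul1g mulgA.
Qed.

Lemma path_end1_word n (w : seq (letter n)) :
  fg_word (path_end 1%g w) = foldr (@push n) [::] w.
Proof.
elim: w => [|l w IH] //.
rewrite [LHS](_ : _ = push l (fg_word (path_end 1%g w))) ?IH//.
transitivity (fg_word (1 * fg_letter l * path_end 1 w)%g).
  by rewrite -path_end_cat_mul.
by rewrite mul1g -IH.
Qed.

Lemma path_end_word n (x : free_group n) : path_end 1%g x = x.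
Proof. by apply: val_inj; rewrite /= path_end1_word foldr_push_nil// fg_reduced. Qed.

Lemma free_group_ind n (P : free_group n -> Prop) : P 1%g ->
  (forall l x, P x -> P (tree_step l x)) -> forall x, P x.
Proof.
move=> P1 PS x; rewrite -(path_end_word x).
elim/last_ind: (fg_word x) => [//|w l IH].
by rewrite /path_end -cats1 foldl_cat; exact: PS.
Qed.

(** * Multiplicative functions of reduced words on the tree *)

Section Monomial.
Variables (R : realType) (n : nat) (u : 'I_n -> R).

Definition wmonomial (w : seq (letter n)) : R := \prod_(l <- w) u l.1.

Definition monomial (x : free_group n) : R := wmonomial (fg_word x).

Lemma wmonomial_inv w : wmonomial (word_inv w) = wmonomial w.
Proof.
rewrite /wmonomial /word_inv big_rev big_map /=.
by rewrite [RHS](eq_bigr (fun l => u (letter_inv l).1)).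
Qed.

(** Passing to inverses turns right multiplication by a letter into [push] at the head of a word. *)
Lemma monomial_step l (x : free_group n) :
  monomial (tree_step l x) = wmonomial (push (letter_inv l) (word_inv x)).
Proof.
rewrite /monomial -wmonomial_inv.
by have -> : word_inv (tree_step l x) = fg_word ((tree_step l x)^-1)%g by [];
  rewrite /tree_step invgM -fg_letterV.
Qed.

Lemma monomial1 : monomial 1%g = 1.
Proof. by rewrite /monomial /wmonomial big_nil. Qed.

Hypothesis u01 : forall i, 0 < u i < 1.

Lemma monomial_gt0 x : 0 < monomial x.
Proof. by apply: prodr_gt0 => l _; have /andP[] := u01 l.1. Qed.

Variables (p : 'I_n -> R) (c kappa : R).
Hypotheses (c_gt0 : 0 < c) (p_gt0 : forall i, 0 < p i).
Hypothesis p_half : \sum_i p i = 2^-1.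
Hypothesis pE : forall i, p i * ((u i)^-1 - u i) = c.
Hypothesis kappaE : kappa = c + 2 * \sum_i p i * u i.

Let p_ge0 i : 0 <= p i. Proof. exact: ltW. Qed.
Let phi_ge0 x : 0 <= monomial x. Proof. exact/ltW/monomial_gt0. Qed.

Let kappa_gt0 : 0 < kappa.
Proof.
rewrite kappaE ltr_wpDr// mulr_ge0// sumr_ge0// => i _.
by rewrite mulr_ge0//; have /andP[/ltW] := u01 i.
Qed.

(** Away from the identity one letter [m] cancels and divides the monomial by [u m.1], while all
    others multiply it by their [u]. The resulting excess [p m.1 * ((u m.1)^-1 - u m.1)] is [c]
    whatever [m] is; at the identity nothing cancels, and the point mass makes up for it. *)
Lemma avg_monomial x :
  avg (@tree_step n) p monomial x + c * (x == 1%g)%:R = kappa * monomial x.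
Proof.
rewrite /avg; under eq_bigr do rewrite monomial_step.
have u0 i : u i != 0 by rewrite gt_eqF//; have /andP[] := u01 i.
have S : \sum_(l : letter n) p l.1 * u l.1 = kappa - c.
  by rewrite (sum_letters (fun i => p i * u i)) kappaE; ring.
have x1 : (x == 1%g) = (word_inv x == [::]).
  apply/eqP/eqP => [->//|H]; apply: (inv_inj (@invgK _)); rewrite invg1.
  exact: val_inj.
rewrite x1 /monomial -wmonomial_inv.
case: (word_inv x) => [|m y] /=.
  rewrite mulr1 /wmonomial big_nil mulr1 -[RHS](subrK c) -S.
  by congr (_ + _); apply: eq_bigr => l _; rewrite big_seq1.
rewrite mulr0 addr0 (bigD1 m)//= letter_invK eqxx.
have E : wmonomial (m :: y) = u m.1 * wmonomial y by rewrite /wmonomial big_cons.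
have -> : \sum_(i | i != m) p i.1 * wmonomial
   (if m == letter_inv (letter_inv i) then y else letter_inv i :: m :: y) =
   (\sum_(i | i != m) p i.1 * u i.1) * wmonomial (m :: y).
  rewrite mulr_suml; apply: eq_bigr => l lm.
  rewrite letter_invK eq_sym (negbTE lm) {1}/wmonomial big_cons /=.
  by rewrite -/(wmonomial (m :: y)) mulrA.
have S' := S; rewrite (bigD1 m)//= in S'.
have -> : \sum_(i | i != m) p i.1 * u i.1 = kappa - c - p m.1 * u m.1.
  by rewrite -S'; ring.
by rewrite E -(pE m.1); field.
Qed.

Notation g := (green (@tree_step n) p kappa 1%g).

Lemma green_le_monomial N x : c * g N x <= monomial x.
Proof.
elim: N x => [|N IH] x; first by rewrite mulr0.
rewrite -(ler_pM2l kappa_gt0) -avg_monomial mulrCA greenS//.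
rewrite mulrDr addrC lerD2r /avg mulr_sumr.
apply: ler_sum => l _; rewrite mulrCA ler_wpM2l//.
Qed.

(** The remainder of the series; by [psiS] it equals [kappa^-N A^N monomial]. *)
Let psi N x := monomial x - c * g N x.

Let psi_ge0 N x : 0 <= psi N x.
Proof. by rewrite subr_ge0 green_le_monomial. Qed.

Let psiS N x : kappa * psi N.+1 x = avg (@tree_step n) p (psi N) x.
Proof.
rewrite /psi mulrBr -avg_monomial [kappa * (c * _)]mulrCA greenS//.
rewrite [c * (_ + _)]mulrDr opprD addrA addrK /avg mulr_sumr -sumrB.
by apply: eq_bigr => l _; ring.
Qed.

(** A one-step Harnack inequality, obtained by keeping one term of [psiS]. It carries convergence to
    0 from a vertex to its neighbours. *)
Let psi_step N l x : psi N (tree_step l x) <= kappa / p l.1 * psi N.+1 x.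
Proof.
rewrite mulrAC ler_pdivlMr// psiS /avg (bigD1 l)//= mulrC lerDl.
by apply: sumr_ge0 => m _; rewrite mulr_ge0.
Qed.

(* With [psi N = monomial - c * g N], symmetry of the averaging operator makes
   [c * psi N 1] the decrement of the bounded sequence
   [kappa * tsum (psi N * monomial)]. *)
Lemma cvg_green x : summ (fun y => monomial y ^+ 2) ->
  c * g N x @[N --> \oo] --> monomial x.
Proof.
move=> s2.
have psim_ge0 N y : 0 <= psi N y * monomial y by rewrite mulr_ge0.
have sm N : summ (fun y => psi N y * monomial y).
  apply: summ_le s2 => y; rewrite expr2 ler_wpM2r// gerBl.
  by rewrite mulr_ge0// ?(ltW c_gt0)//; apply: green_ge0.
pose m N := fine (tsum (fun y => psi N y * monomial y)).
have mE N : tsum (fun y => psi N y * monomial y) = (m N)%:E.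
  by rewrite fineK// summ_fin.
have m0 N : 0 <= m N by rewrite -lee_fin -mE tsum_ge0.
have mS N : c * psi N 1%g = kappa * m N - kappa * m N.+1.
  have : tsum (fun y => psi N y * (kappa * monomial y)) =
         (tsum (fun y => avg (@tree_step n) p (psi N) y * monomial y)%R +
          (c * psi N 1%g)%:E)%E.
    rewrite (@tsum_avgM _ _ _ _ (@tree_stepK n))//.
    rewrite -(@tsum_delta R (free_group n) 1%g (c * psi N 1%g)) ?mulr_ge0 ?(ltW c_gt0)//.
    rewrite -tsumD; last first.
    - by move=> y; rewrite mulrn_wge0// mulr_ge0// ltW.
    - by move=> y; rewrite mulr_ge0// avg_ge0.
    congr tsum; apply/funext => y; rewrite -avg_monomial mulrDr.
    by congr (_ + _); case: eqP => [->|_]; rewrite /= ?mulr1 ?mulr0// mulrC.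
  under eq_fun do rewrite mulrCA.
  under [X in _ = (tsum X + _)%E -> _]eq_fun do rewrite -psiS -mulrA.
  rewrite !tsumZ ?(ltW kappa_gt0)// !mE -!EFinM -EFinD => -[->].
  by rewrite addrAC subrr add0r.
have cm : cvgn m.
  apply: nonincreasing_is_cvgn; last by exists 0 => _ [N _ <-].
  apply/nonincreasing_seqP => N; rewrite -(ler_pM2l kappa_gt0) -subr_ge0 -mS.
  by rewrite mulr_ge0// ltW.
have psi1 : psi N 1%g @[N --> \oo] --> 0.
  have -> : (fun N => psi N 1%g) = (fun N => (kappa / c) * (m N - m N.+1)).
    apply/funext => N; rewrite mulrAC mulrBr -mS mulrAC mulfV ?mul1r//.
    by rewrite gt_eqF.
  rewrite -(mulr0 (kappa / c)) -(subrr (limn m)); apply: cvgMl_tmp; apply: cvgB => //.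
  by rewrite (cvg_shiftS m).
have psi0 y : psi N y @[N --> \oo] --> 0.
  elim/free_group_ind: y => [//|l y IH].
  apply: (@squeeze_cvgr _ _ _ _ (fun=> 0) (fun N => kappa / p l.1 * psi N.+1 y)).
  - by near=> N; rewrite psi_ge0 psi_step.
  - exact: cvg_cst.
  - rewrite -(mulr0 (kappa / p l.1)); apply: cvgMl_tmp.
    by rewrite (cvg_shiftS (fun N => psi N y)).
have -> : (fun N => c * g N x) = (fun N => monomial x - psi N x).
  by apply/funext => N; rewrite /psi opprB addrC subrK.
rewrite -[X in _ --> X]subr0; apply: cvgB => //; exact: cvg_cst.
Unshelve. all: by end_near.
Qed.

(** Transfers bounds that are uniform in [N] from the truncated Green functions to the monomial. *)
Lemma monomial_fset_le (X : {fset free_group n}) (M : R) :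
  summ (fun y => monomial y ^+ 2) ->
  (forall N, \sum_(x <- X) g N x <= M) -> \sum_(x <- X) monomial x <= c * M.
Proof.
move=> s2 gM.
have cv : \sum_(x <- X) c * g N x @[N --> \oo] --> \sum_(x <- X) monomial x.
  by apply: cvg_sum_seq => x; exact: cvg_green.
rewrite -(cvg_lim (@Rhausdorff R) cv); apply: limr_le; first exact: cvgP cv.
by near=> N; rewrite -mulr_sumr ler_wpM2l// ltW.
Unshelve. all: by end_near.
Qed.

(** Summing [avg_monomial] over the tree gives [kappa S = S + c] with [c > 0]. *)
Lemma summ_monomial_kappa : summ monomial -> 1 < kappa.
Proof.
move=> sm; have Sf := fineK (summ_fin phi_ge0 sm).
have : tsum (fun x => kappa * monomial x) = (tsum monomial + c%:E)%E.
  have p1 : 2 * \sum_i p i = 1 by rewrite p_half mulfV.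
  rewrite -[X in (X + _)%E]mul1e -p1.
  rewrite -(tsum_avg (@tree_stepK n))// -(@tsum_delta R (free_group n) 1%g c) ?(ltW c_gt0)//.
  rewrite -tsumD; last first.
  - by move=> y; rewrite mulrn_wge0// ltW.
  - by move=> y; rewrite avg_ge0.
  congr tsum; apply/funext => y; rewrite -avg_monomial; congr (_ + _).
  by case: eqP => _; rewrite ?mulr1 ?mulr0.
rewrite tsumZ ?(ltW kappa_gt0)// -Sf -EFinM -EFinD => -[].
have := tsum_ge0 phi_ge0; rewrite -Sf lee_fin.
move: (fine _) => S S0 E.
rewrite ltNge; apply/negP => k1.
have : kappa * S <= 1 * S by rewrite ler_wpM2r.
by rewrite E mul1r gerDl leNgt c_gt0.
Qed.

(** The masses [T N] of [g N] satisfy [kappa T(N+1) = 1 + T(N)], so they stay below the fixed point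
    [1 / (kappa - 1)]. Square summability then identifies the limit of [c * g N] as the monomial. *)
Lemma kappa_summ_monomial : 1 < kappa ->
  summ (fun y => monomial y ^+ 2) -> summ monomial.
Proof.
move=> k1 s2.
have g0 N x : 0 <= g N x by apply: green_ge0.
have gle N : (tsum (g N) <= ((kappa - 1)^-1)%:E)%E.
  elim: N => [|N IH].
    by rewrite /tsum esum1// lee_fin invr_ge0 subr_ge0 ltW.
  have : (kappa%:E * tsum (g N.+1) = 1%:E + tsum (g N))%E.
    rewrite -tsumZ ?(ltW kappa_gt0)//.
    under eq_fun do rewrite greenS//.
    rewrite tsumD; last first.
    - by move=> y; rewrite avg_ge0.
    - by move=> y; exact: ler0n.
    rewrite (tsum_delta _ ler01) (tsum_avg (@tree_stepK n))// p_half mulfV//.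
    by rewrite mul1e.
  have sS := summ_fin (g0 N.+1) (green_summ (@tree_stepK n) 1%g p_ge0 kappa_gt0 N.+1).
  have sN := summ_fin (g0 N) (green_summ (@tree_stepK n) 1%g p_ge0 kappa_gt0 N).
  move: IH; rewrite -(fineK sS) -(fineK sN); move: (fine _) (fine _) => a b.
  rewrite -EFinM -EFinD !lee_fin => ab [E].
  have k0 : 0 < kappa - 1 by rewrite subr_gt0.
  rewrite -(ler_pM2l kappa_gt0) E.
  have -> : kappa * (kappa - 1)^-1 = 1 + (kappa - 1)^-1.
    by field; rewrite gt_eqF.
  by rewrite lerD2l.
apply: (@le_lt_trans _ _ (c * (kappa - 1)^-1)%:E); last exact: ltry.
apply: tsum_fset_le => X; apply: monomial_fset_le => // N.
by rewrite -lee_fin (le_trans _ (gle N))//; exact: tsum_fset.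
Qed.

End Monomial.

(* The restriction [h N] of the monomial to words of length at most [N] satisfies
   [h N.+1 <= delta_1 + avg v (h N)], since dropping the last letter of a
   nonempty reduced word is a step towards the identity. *)
Lemma summ_monomial_small (R : realType) (n : nat) (v : 'I_n -> R) :
  (forall i, 0 < v i < 1) -> 2 * \sum_i v i < 1 -> summ (monomial v).
Proof.
move=> v01 v1; have v0 i : 0 <= v i by have /andP[/ltW] := v01 i.
pose h N x : R := monomial v x *+ (size (fg_word x) <= N)%N.
have h0 N x : 0 <= h N x by rewrite mulrn_wge0// ltW// monomial_gt0.
have hS N x : h N.+1 x <= (x == 1%g)%:R + avg (@tree_step n) v (h N) x.
  have a0 : 0 <= avg (@tree_step n) v (h N) x by exact: avg_ge0.
  have [->|x1] := eqVneq x 1%g.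
    by rewrite [leLHS]/h monomial1 /= mulr1n lerDl; exact: avg_ge0.
  rewrite add0r /h; have sx : size (fg_word x) = size (word_inv x).
    by rewrite /word_inv size_rev size_map.
  have mx := wmonomial_inv v x.
  case E : (word_inv x) => [|m y].
    by case/eqP: x1; apply: (inv_inj (@invgK _)); apply: val_inj; rewrite /= E.
  have Ex : word_inv (tree_step m x) = y.
    have -> : word_inv (tree_step m x) = fg_word ((tree_step m x)^-1)%g by [].
    by rewrite /tree_step invgM -fg_letterV /= E /= letter_invK eqxx.
  have sy : size (fg_word (tree_step m x)) = size y.
    by rewrite -Ex /word_inv size_rev size_map.
  rewrite sx E /avg (bigD1 m)//=.
  apply: (@le_trans _ _ (v m.1 * (monomial v (tree_step m x) *+
    (size (fg_word (tree_step m x)) <= N)%N))); last first.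
    by rewrite lerDl; apply: sumr_ge0 => l _; rewrite mulr_ge0// -/(h _ _).
  rewrite /monomial -mx E -(wmonomial_inv v (tree_step m x)) Ex sy ltnS.
  by rewrite /wmonomial big_cons mulrnAr.
(* The bound is the fixed point of [t -> 1 + 2 (\sum_i v i) t]. *)
have tB N : (tsum (h N) <= ((1 - 2 * \sum_i v i)^-1)%:E)%E.
  have d0 : 0 < 1 - 2 * \sum_i v i by rewrite subr_gt0.
  have q0 : 0 <= 2 * \sum_i v i by rewrite mulr_ge0// sumr_ge0.
  elim: N => [|N IH].
    apply: (@le_trans _ _ 1%:E); last by rewrite lee_fin invf_ge1// gerBl.
    rewrite -(@tsum_delta R (free_group n) 1%g 1)//; apply: tsum_le => x.
    rewrite /h leqn0 size_eq0; have [->|x1] := eqVneq x 1%g.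
      by rewrite monomial1.
    rewrite (_ : _ == _ = false)//; apply/negbTE; apply: contra_neq x1 => x1.
    exact: val_inj.
  apply: le_trans (tsum_le (hS N)) _.
  rewrite tsumD; [|by move=> x; exact: ler0n|by apply: avg_ge0].
  rewrite (tsum_delta _ ler01) (tsum_avg (@tree_stepK n))//.
  apply: (@le_trans _ _ (1 + (2 * \sum_i v i)%:E * ((1 - 2 * \sum_i v i)^-1)%:E)%E).
    by rewrite leeD2l// lee_wpmul2l// lee_fin.
  rewrite -EFinM -EFinD lee_fin le_eqVlt; apply/orP; left; apply/eqP.
  by field; rewrite gt_eqF.
apply: (@le_lt_trans _ _ ((1 - 2 * \sum_i v i)^-1)%:E); last exact: ltry.
apply: tsum_fset_le => X.
(* For this [N] the truncation changes nothing on [X]. *)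
pose N := (\max_(x <- X) size (fg_word x))%N.
have -> : \sum_(x <- X) monomial v x = \sum_(x <- X) h N x.
  rewrite big_seq_cond [RHS]big_seq_cond; apply: eq_bigr => x.
  rewrite andbT => xX; rewrite /h (_ : (_ <= _)%N)// /N (big_rem x)//=.
  exact: leq_maxl.
by rewrite -lee_fin (le_trans _ (tB N))//; exact: tsum_fset.
Qed.

(** * The quotient graph *)

Section Quotient.
Variables (n : nat) (G : set (free_group n)).
Implicit Types (C : quotient_vertex G) (x y : free_group n).

Lemma vertex_inj C C' : val C = val C' -> C = C'.
Proof. exact: val_inj. Qed.

Definition quotient_step (l : letter n) C : quotient_vertex G :=
  vertex_mul C (fg_letter l).

Lemma val_vertex_mul C x : val (vertex_mul C x) = [set (y * x)%g | y in val C].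
Proof. by []. Qed.

Lemma vertex_mulM C x y : vertex_mul (vertex_mul C x) y = vertex_mul C (x * y)%g.
Proof.
apply: vertex_inj; rewrite /= image_comp; apply: eq_imagel => z _ /=.
by rewrite mulgA.
Qed.

Lemma vertex_mul1 C : vertex_mul C 1%g = C.
Proof.
apply: vertex_inj => /=; rewrite -[RHS]image_id; apply: eq_imagel => z _.
exact: mulg1.
Qed.

Lemma quotient_stepK l : cancel (quotient_step l) (quotient_step (letter_inv l)).
Proof.
by move=> C; rewrite /quotient_step vertex_mulM fg_letterV mulgV vertex_mul1.
Qed.

Lemma mem_quotient_step C l x :
  val (quotient_step l C) (tree_step l x) <-> val C x.
Proof.
split=> [[y Cy]|Cx]; last by exists x.
by rewrite /tree_step => /mulIg <-.
Qed.

Definition base_vertex : quotient_vertex G :=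
  exist (fun D : set (free_group n) => D \in range (coset_set G))
    (coset_set G 1%g)
    (mem_set (imageT (coset_set G) 1%g)).

Lemma base_vertexE : val base_vertex = G.
Proof.
rewrite /= /coset_set -[RHS]image_id; apply: eq_imagel => z _; exact: mulg1.
Qed.

(** Connectedness of the quotient graph. *)
Lemma quotient_vertex_ind (P : quotient_vertex G -> Prop) : P base_vertex ->
  (forall l C, P C -> P (quotient_step l C)) -> forall C, P C.
Proof.
move=> P0 PS C.
have [x ->] : exists x, C = vertex_mul base_vertex x.
  have [x _ xE] := set_mem (valP C); exists x; apply: vertex_inj.
  rewrite -xE /= /coset_set image_comp; apply: eq_imagel => g _ /=.
  by rewrite mulg1.
elim/free_group_ind: x => [|l x IH]; first by rewrite vertex_mul1.
by rewrite /tree_step -vertex_mulM; exact: PS.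
Qed.

Hypothesis G_subgroup : group_closed [in G].

Let G1 : G 1%g.
Proof. by apply/set_mem; case: G_subgroup. Qed.

Let Gdiv h k : G h -> G k -> G (h / k)%g.
Proof.
by move=> /mem_set Gh /mem_set Gk; apply/set_mem; case: G_subgroup => _; apply.
Qed.

(** Cosets that share an element coincide; this uses that [G] is closed under division. *)
Lemma mem_vertex C x : val C x -> C = vertex_mul base_vertex x.
Proof.
have [x0 _ x0E] := set_mem (valP C); rewrite -x0E => -[g Gg gx].
have Gg' : G (g^-1)%g by rewrite -[(g^-1)%g]mul1g; exact: Gdiv.
apply: vertex_inj; rewrite val_vertex_mul base_vertexE -x0E.
apply/seteqP; split=> [_ [h Gh <-]|_ [h Gh <-]].
  by exists (h / g)%g; [exact: Gdiv|rewrite -gx mulgA mulgVK].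
exists (h * g)%g; first by rewrite -(invgK g); exact: Gdiv.
by rewrite -gx mulgA.
Qed.

Lemma mem_vertex_mul x : val (vertex_mul base_vertex x) x.
Proof.
by rewrite val_vertex_mul base_vertexE; exists 1%g => //; exact: mul1g.
Qed.

(** * Push-forward of functions from the tree to the quotient *)

Section CosetSum.
Variable R : realType.
Implicit Types (f : free_group n -> R).

Definition coset_sum f C : \bar R := \esum_(y in val C) (f y)%:E.

Lemma coset_sumE f C : coset_sum f C = tsum (fun y => (y \in val C)%:R * f y).
Proof.
rewrite /coset_sum esum_mkcond; apply: eq_esum => y _.
by case: (y \in val C); rewrite ?mul1r ?mul0r.
Qed.

Lemma coset_sum_ge0 f C : (forall y, 0 <= f y) -> (0 <= coset_sum f C)%E.
Proof. by move=> f0; apply: esum_ge0 => y _; rewrite lee_fin. Qed.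

Lemma coset_sum_le f h C : (forall y, f y <= h y) ->
  (coset_sum f C <= coset_sum h C)%E.
Proof. by move=> fh; apply: le_esum => y _; rewrite lee_fin. Qed.

Lemma coset_sumD f h C : (forall y, 0 <= f y) -> (forall y, 0 <= h y) ->
  coset_sum (fun y => f y + h y) C = (coset_sum f C + coset_sum h C)%E.
Proof.
by move=> f0 h0; rewrite /coset_sum -esumD// => y _; rewrite lee_fin.
Qed.

Lemma coset_sumZ (c : R) f C : 0 <= c -> (forall y, 0 <= f y) ->
  coset_sum (fun y => c * f y) C = (c%:E * coset_sum f C)%E.
Proof.
move=> c0 f0; rewrite !coset_sumE -tsumZ//; last by move=> y; rewrite mulr_ge0.
by congr tsum; apply/funext => y; rewrite mulrCA.
Qed.

Lemma coset_sum_step f C l :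
  coset_sum (fun y => f (tree_step l y)) C = coset_sum f (quotient_step l C).
Proof.
rewrite !coset_sumE.
rewrite -[RHS](tsum_reindex _ (@tree_stepK n l) (stepVK (@tree_stepK n) l)).
congr tsum; apply/funext => y /=; congr (_%:R * _).
congr (nat_of_bool _); apply/idP/idP => /set_mem Cy; apply/mem_set.
  exact/mem_quotient_step.
exact/(mem_quotient_step C l).
Qed.

(** Push-forward intertwines the averaging operators, since a letter maps each coset bijectively
    onto the neighbouring one. *)
Lemma coset_sum_avg (p : 'I_n -> R) f C : (forall i, 0 <= p i) ->
  (forall y, 0 <= f y) ->
  coset_sum (avg (@tree_step n) p f) C =
  (\sum_(l : letter n) (p l.1)%:E * coset_sum f (quotient_step l C))%E.
Proof.
move=> p0 f0; rewrite [LHS]/coset_sum.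
under eq_esum do rewrite /avg -sumEFin.
rewrite esum_sum => [|y l _ _]; last by rewrite lee_fin mulr_ge0.
apply: eq_bigr => l _; rewrite -coset_sum_step -coset_sumZ//.
Qed.

Lemma coset_sum_delta C :
  coset_sum (fun y => (y == 1%g)%:R) C = ((C == base_vertex)%:R)%:E.
Proof.
rewrite coset_sumE.
rewrite (_ : (fun y => _) = (fun y => ((1%g \in val C)%:R : R) *+ (y == 1%g))).
  rewrite tsum_delta ?ler0n//; congr (_%:R)%:E; congr (nat_of_bool _).
  apply/idP/eqP => [/set_mem /mem_vertex ->|->]; first by rewrite vertex_mul1.
  by rewrite base_vertexE; exact: mem_set.
apply/funext => y; case: eqP => [->|_]; first by rewrite mulr1.
by rewrite mulr0 mulr0n.
Qed.

Lemma tsum_coset_sum f : (forall y, 0 <= f y) ->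
  tsum f = \esum_(C in [set: quotient_vertex G]) coset_sum f C.
Proof.
move=> f0; rewrite [RHS]esum_esum => [|C y _ _]; last by rewrite lee_fin.
rewrite [RHS](reindex_esum setT _
  (fun y => (vertex_mul base_vertex y, y)))//; split.
- by move=> y _; split => //=; exact: mem_vertex_mul.
- by move=> y z _ _ [].
- by move=> [C y] [_ /= Cy]; exists y => //; rewrite -(mem_vertex Cy).
Qed.

(** Both functions obey the same recursion, and the point mass at the identity is pushed to the one
    at [base_vertex]. *)
Lemma coset_sum_green (p : 'I_n -> R) kappa N C :
  (forall i, 0 <= p i) -> 0 < kappa ->
  coset_sum (green (@tree_step n) p kappa 1%g N) C =
  (green quotient_step p kappa base_vertex N C)%:E.
Proof.
move=> p0 k0; elim: N C => [|N IH] C.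
  by rewrite /coset_sum esum1.
have g0 x : 0 <= green (@tree_step n) p kappa 1%g N x by apply: green_ge0.
have ag0 x : 0 <= avg (@tree_step n) p (green (@tree_step n) p kappa 1%g N) x.
  exact: avg_ge0.
rewrite [X in coset_sum X]/=.
under [X in coset_sum X]eq_fun do rewrite mulrC.
rewrite coset_sumZ ?invr_ge0 ?(ltW k0)//; last first.
  by move=> y; rewrite addr_ge0 ?ler0n.
rewrite coset_sumD//.
rewrite coset_sum_delta coset_sum_avg//.
under eq_bigr do rewrite IH -EFinM.
by rewrite sumEFin -EFinD -EFinM /= mulrC.
Qed.

(** Two readings of the [l^2] bound on the quotient: the value at [base_vertex] is the sum over [G],
    and on each coset the sum of squares is at most the square of the sum. *)
Lemma gap_green_coset (p : 'I_n -> R) kappa mu N :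
  (forall i, 0 <= p i) -> \sum_i p i = 2^-1 -> 0 < kappa ->
  gap quotient_step p mu -> 1 - kappa < mu ->
  (coset_sum (green (@tree_step n) p kappa 1%g N) base_vertex <=
     ((mu - (1 - kappa))^-1)%:E)%E /\
  (tsum (fun y => green (@tree_step n) p kappa 1%g N y ^+ 2)%R <=
     ((mu - (1 - kappa)) ^- 2)%:E)%E.
Proof.
move=> p0 p1 k0 gp kmu.
have d0 : 0 < mu - (1 - kappa) by rewrite subr_gt0.
have := gap_green_bound quotient_stepK base_vertex p0 k0 N p1 gp kmu.
set gQ := green quotient_step _ _ _ _ => gb.
set gT := green _ _ _ _ _.
have gT0 x : 0 <= gT x by apply: green_ge0.
have gQ0 C : 0 <= gQ C by apply: green_ge0.
have TQ C : coset_sum gT C = (gQ C)%:E by exact: coset_sum_green.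
split.
  rewrite TQ lee_fin -(@ler_pXn2r _ 2) ?nnegrE ?invr_ge0 ?(ltW d0)//.
  rewrite exprVn -lee_fin (le_trans _ gb)//.
  by apply: (@tsum_point _ _ (fun C => gQ C ^+ 2)) => C; exact: sqr_ge0.
apply: le_trans gb; rewrite tsum_coset_sum; last by move=> y; exact: sqr_ge0.
apply: le_esum => C _.
apply: (@le_trans _ _ (coset_sum (fun y => gQ C * gT y) C)); last first.
  by rewrite coset_sumZ// TQ -EFinM expr2.
apply: le_esum => y Cy; rewrite lee_fin expr2 ler_wpM2r// -lee_fin -TQ.
apply: esum_ge; exists [set y]; last by rewrite fsbig_set1.
by split=> // _ ->.
Qed.

(** * Lower bound on the spectrum from a convergent Poincare series *)

Section Poincare.
Variables (phi : free_group n -> R) (p : 'I_n -> R) (c kappa : R).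
Hypotheses (c_ge0 : 0 <= c) (p_gt0 : forall i, 0 < p i).
Hypothesis p_half : \sum_i p i = 2^-1.
Hypothesis phi_gt0 : forall x, 0 < phi x.
Hypothesis kappa_ge0 : 0 <= kappa.
Hypothesis avg_phi : forall x,
  avg (@tree_step n) p phi x + c * (x == 1%g)%:R = kappa * phi x.

(** The push-forward [F] of [phi] is a positive supersolution for Barta's principle. It is finite
    everywhere because [phi (tree_step l y) <= kappa / p l.1 * phi y] and the quotient is
    connected. *)
Lemma gap_poincare : (coset_sum phi base_vertex < +oo)%E ->
  gap quotient_step p (1 - kappa).
Proof.
move=> fin0.
have p0 i : 0 <= p i by exact: ltW.
have phi0 x : 0 <= phi x by exact: ltW.
have fin C : coset_sum phi C \is a fin_num.
  rewrite ge0_fin_numE ?coset_sum_ge0//.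
  elim/quotient_vertex_ind: C => [//|l C IH].
  rewrite -coset_sum_step.
  apply: (@le_lt_trans _ _ (coset_sum (fun y => kappa / p l.1 * phi y) C)).
    apply: coset_sum_le => y; rewrite mulrAC ler_pdivlMr// -avg_phi.
    rewrite -[X in X <= _]addr0 lerD ?mulr_ge0 ?ler0n//.
    rewrite /avg (bigD1 l)//= mulrC lerDl.
    by apply: sumr_ge0 => m _; rewrite mulr_ge0.
  have IH' : coset_sum phi C \is a fin_num by rewrite ge0_fin_numE ?coset_sum_ge0.
  by rewrite coset_sumZ ?divr_ge0// -(fineK IH') -EFinM ltry.
pose F C := fine (coset_sum phi C).
have FE C : coset_sum phi C = (F C)%:E by rewrite fineK.
apply: (gap_supersolution quotient_stepK (F := F)) => // C.
  have [x _ xE] := set_mem (valP C).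
  have Cx : val C x by rewrite -xE; exists 1%g => //; rewrite mul1g.
  rewrite -lte_fin -FE; apply: (@lt_le_trans _ _ (phi x)%:E); first by rewrite lte_fin.
  apply: esum_ge; exists [set x]; last by rewrite fsbig_set1.
  by split=> // _ ->.
rewrite -lee_fin EFinM -FE -coset_sumZ//.
under [X in coset_sum X]eq_fun do rewrite -avg_phi.
rewrite coset_sumD; last first.
- by move=> y; rewrite mulr_ge0 ?ler0n.
- exact: avg_ge0.
rewrite coset_sum_avg// /avg -sumEFin.
under eq_bigr do rewrite EFinM -FE.
by rewrite leeDl// coset_sum_ge0// => y; rewrite mulr_ge0 ?ler0n.
Qed.

End Poincare.

End CosetSum.
End Quotient.

(** * Critical exponents and Poincare series *)

Section CriticalExponent.
Variables (R : realType) (n : nat) (r : 'I_n -> R).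
Hypothesis r_weights : weights r.

Let r_gt0 i : 0 < r i. Proof. by case: r_weights. Qed.

Let r_le i : r i <= 2^-1.
Proof.
case: r_weights => <- _; rewrite (bigD1 i)//= lerDl.
by apply: sumr_ge0 => j _; exact: ltW.
Qed.

Let lnr_ge i : ln 2 <= - ln (r i).
Proof. by rewrite -lnV ?posrE// ler_ln ?posrE ?invr_gt0// -[2]invrK lef_pV2 ?posrE. Qed.

Let ln2_gt0 : 0 < ln (2 : R).
Proof. by rewrite ln_gt0// ltr1n. Qed.

Let lnr_ge0 i : 0 <= - ln (r i).
Proof. by apply: le_trans (lnr_ge i); exact: ltW. Qed.

Definition word_length (x : free_group n) : R := path_length r x.

Lemma wmonomial_expR s w :
  wmonomial (H_map r s) w = expR (- (s * path_length r w)).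
Proof.
rewrite /wmonomial /path_length mulr_sumr -sumrN expR_sum.
by apply: eq_bigr => l _; rewrite /H_map /powR gt_eqF// mulrN opprK.
Qed.

Lemma monomial_expR s x : monomial (H_map r s) x = expR (- (s * word_length x)).
Proof. exact: wmonomial_expR. Qed.

Lemma path_length_ge0 w : 0 <= path_length r w.
Proof. by apply: sumr_ge0. Qed.

Lemma path_length_push l w :
  path_length r (push l w) <= - ln (r l.1) + path_length r w.
Proof.
rewrite /path_length; case: w => [|m w] /=; first by rewrite !big_cons !big_nil.
case: ifP => _; rewrite !big_cons// addrA lerDr addr_ge0//.
Qed.

Lemma path_length_inv w : path_length r (word_inv w) = path_length r w.
Proof.
rewrite /path_length /word_inv big_rev big_map /=.
by rewrite [RHS](eq_bigr (fun l => - ln (r (letter_inv l).1))).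
Qed.

Lemma word_length_step l x :
  word_length (tree_step l x) <= word_length x - ln (r l.1).
Proof.
rewrite /word_length -path_length_inv -(path_length_inv x).
have -> : word_inv (tree_step l x) = fg_word ((tree_step l x)^-1)%g by [].
rewrite /tree_step invgM -fg_letterV addrC.
exact: (path_length_push (letter_inv l)).
Qed.

(** The reduced word is a geodesic: appending an edge to a path lengthens the reduced word of its
    endpoint by at most the length of that edge. *)
Lemma cayley_dist1E x : cayley_dist r 1%g x = word_length x.
Proof.
have lb w : word_length (path_end 1%g w) <= path_length r w.
  elim/last_ind: w => [|w l IH]; first exact: lexx.
  rewrite /path_end -cats1 foldl_cat /= -/(path_end _ _).
  apply: le_trans (word_length_step _ _) _.
  by rewrite /path_length cats1 big_rcons lerD2r.
apply/eqP; rewrite eq_le; apply/andP; split.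
  apply: ge_inf; last by exists x => //=; exact: path_end_word.
  by exists 0 => _ [w _ <-]; exact: path_length_ge0.
apply: lb_le_inf; first by exists (word_length x), x => //=; exact: path_end_word.
by move=> _ [w <- <-].
Qed.

Lemma finite_words (T : finType) N : finite_set [set w : seq T | (size w <= N)%N].
Proof.
elim: N => [|N IH].
  by apply: (@sub_finite_set _ _ [set [::]]) => // -[].
apply: (@sub_finite_set _ _ ([set [::]] `|`
  ((fun q : T * seq T => q.1 :: q.2) @` ([set: T] `*` [set w | (size w <= N)%N])))).
  move=> [|a w] /= sw; [by left|right; by exists (a, w)].
by rewrite finite_setU; split => //; apply: finite_image; apply: finite_setX.
Qed.

(** As [r i <= 1/2], each edge has length at least [ln 2], so a word of length at most [t] has at
    most [t / ln 2] letters. *)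
Lemma finite_word_ball (G : set (free_group n)) t :
  finite_set [set g | G g /\ word_length g <= t].
Proof.
have inj : injective (@fg_word n) by exact: val_inj.
apply: (@sub_finite_set _ _
  (@fg_word n @^-1` [set w | (size w <= Num.truncn (t / ln 2))%N])); last first.
  by apply: finite_preimage; [move=> x y _ _; exact: inj|exact: finite_words].
move=> g [_ gt] /=; rewrite truncn_ge_nat; last first.
  by rewrite divr_ge0 ?(ltW ln2_gt0)// (le_trans _ gt)// path_length_ge0.
rewrite ler_pdivlMr// (le_trans _ gt)// /word_length /path_length.
elim: (fg_word g) => [|l w IH]; first by rewrite big_nil mul0r.
by rewrite big_cons /= -natr1 mulrDl mul1r addrC lerD.
Qed.

(** * Orbit growth against convergence of the Poincare series *)

Section Orbit.
Variable G : set (free_group n).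

Let ball t := [set g | G g /\ word_length g <= t].

Lemma orbit_countE t : orbit_count G r t = #|` fset_set (ball t)|.
Proof.
congr #|` fset_set _ |; apply/seteqP.
by split=> g /=; rewrite cayley_dist1E.
Qed.

Lemma orbit_count_le t t' : t <= t' -> (orbit_count G r t <= orbit_count G r t')%N.
Proof.
move=> tt'; rewrite !orbit_countE; apply: fsubset_leq_card.
rewrite -fset_set_sub; try exact: finite_word_ball.
by move=> g [Gg gt]; split=> //; exact: le_trans tt'.
Qed.

Lemma orbit_count_gt0 t : G 1%g -> 0 <= t -> (0 < orbit_count G r t)%N.
Proof.
move=> G1 t0; rewrite orbit_countE cardfs_gt0; apply/fset0Pn; exists 1%g.
rewrite in_fset_set; last exact: finite_word_ball.
apply/mem_set; split => //; rewrite /word_length /path_length.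
by rewrite big_nil.
Qed.

Definition poincare s : \bar R := \esum_(x in G) (monomial (H_map r s) x)%:E.

(** Markov's inequality: every orbit point in the ball contributes at least [exp (- s t)] to the
    series. *)
Lemma orbit_count_poincare s t M : 0 <= s -> (poincare s <= M%:E)%E ->
  (orbit_count G r t)%:R <= M * expR (s * t).
Proof.
move=> s0 sM; rewrite -ler_pdivrMr ?expR_gt0// -expRN -lee_fin.
apply: le_trans sM; apply: esum_ge; exists (ball t).
  by split; [exact: finite_word_ball|move=> g []].
rewrite fsbig_finite; last exact: finite_word_ball.
rewrite sumEFin lee_fin orbit_countE card_fset_sum1 natr_sum mulr_suml.
rewrite big_seq_cond [leRHS]big_seq_cond; apply: ler_sum => g.
rewrite andbT in_fset_set; last exact: finite_word_ball.
move=> /set_mem [_ gt]; rewrite mul1r monomial_expR ler_expR lerN2.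
exact: ler_wpM2l.
Qed.

Let growth (t : R) := (ln (orbit_count G r t)%:R / t)%:E.
Let L : \bar R := limf_esup growth +oo%R.

Hypothesis G1 : G 1%g.

Lemma limf_esup_growth_ge0 : (0 <= L)%E.
Proof.
apply: le_ereal_inf_tmp => _ [V [M [_ MV]] <-].
pose t := Num.max M 0 + 1.
have t0 : 0 < t by rewrite ltr_wpDl// le_max lexx orbT.
apply: (@le_trans _ _ (growth t)).
  by rewrite lee_fin divr_ge0 ?(ltW t0)// ln_ge0// ler1n orbit_count_gt0// ltW.
by apply: ereal_sup_ubound; exists t => //; apply: MV; rewrite ltr_pwDr// le_max lexx.
Qed.

Lemma limf_esup_growth_le s : 0 <= s -> (poincare s < +oo)%E -> (L <= s%:E)%E.
Proof.
move=> s0 sfin.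
have P0 : (0 <= poincare s)%E.
  by apply: esum_ge0 => x _; rewrite lee_fin monomial_expR expR_ge0.
have PE : poincare s = (fine (poincare s))%:E by rewrite fineK// ge0_fin_numE.
set S := fine (poincare s) in PE; have S0 : 0 <= S by rewrite -lee_fin -PE.
apply/lee_addgt0Pr => e e0; rewrite -EFinD.
(* Beyond [M] the radius is positive and [ln (S + 1) / t] is below [e]; the [+ 1] keeps the argument
   of the logarithm positive. *)
pose M := Num.max 1 (ln (S + 1) / e).
apply: (@le_trans _ _ (ereal_sup (growth @` [set t | M < t]))).
  apply: ereal_inf_lbound; exists [set t | M < t] => //.
  by exists M; split => //; exact: num_real.
apply: ge_ereal_sup => _ [t /= Mt <-].
have t0 : 0 < t by apply: lt_trans Mt; rewrite lt_max ltr01.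
rewrite lee_fin ler_pdivrMr//.
have N0 : 0 < (orbit_count G r t)%:R :> R.
  by rewrite ltr0n orbit_count_gt0// ltW.
have SM : (poincare s <= (S + 1)%:E)%E by rewrite PE lee_fin lerDl.
have := orbit_count_poincare t s0 SM.
rewrite -ler_ln ?posrE//; last by rewrite mulr_gt0 ?expR_gt0// ltr_wpDl.
rewrite lnM ?posrE ?expR_gt0 ?ltr_wpDl// expRK => /le_trans; apply.
rewrite addrC mulrDl lerD2l mulrC -ler_pdivrMr// ltW//.
by apply: le_lt_trans Mt; rewrite le_max lexx orbT.
Qed.

Hypothesis L_fin : L \is a fin_num.

Lemma critical_exponentE : L = (critical_exponent G r)%:E.
Proof. by rewrite fineK. Qed.

Lemma orbit_count_exponent t : critical_exponent G r < t ->
  exists2 M, 0 <= M & forall T, M < T -> (orbit_count G r T)%:R <= expR (t * T).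
Proof.
rewrite -lte_fin -critical_exponentE => /ereal_inf_lt[_ [V [M [_ MV]] <-] Vt].
exists (Num.max M 0); first by rewrite le_max lexx orbT.
move=> T; rewrite gt_max => /andP[MT T0].
have N0 : 0 < (orbit_count G r T)%:R :> R.
  by rewrite ltr0n orbit_count_gt0// ltW.
rewrite -ler_ln ?posrE ?expR_gt0// expRK -ler_pdivrMr// -lee_fin ltW//.
by apply: le_lt_trans Vt; apply: ereal_sup_ubound; exists T => //; exact: MV.
Qed.

(** Unit shells: at most [K exp (t k)] points have length in [[k, k + 1[], each contributing at most
    [exp (- s k)]. With [t] halfway between the exponent and [s], the series is dominated by a
    geometric one of ratio [exp (t - s)]. *)
Lemma poincare_fin s : critical_exponent G r < s -> (poincare s < +oo)%E.
Proof.
move=> ds; pose d := critical_exponent G r; pose t := (d + s) / 2.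
have d0 : 0 <= d by rewrite -lee_fin -critical_exponentE limf_esup_growth_ge0.
have dt : d < t by rewrite /t midf_lt.
have ts : t < s by rewrite /t midf_lt.
have [M M0 Nt] := orbit_count_exponent dt.
pose K := expR t + (orbit_count G r M)%:R.
have NK k : (orbit_count G r k.+1%:R)%:R <= K * expR (t * k%:R).
  have t0 : 0 <= t by rewrite ltW// (le_lt_trans d0).
  rewrite /K mulrDl -expRD; have [kM|Mk] := leP k.+1%:R M.
    rewrite ler_wpDl ?expR_ge0//.
    apply: (@le_trans _ _ ((orbit_count G r M)%:R)).
      by rewrite ler_nat orbit_count_le.
    rewrite ler_peMr// -expR0 ler_expR mulr_ge0//.
  rewrite ler_wpDr ?mulr_ge0 ?expR_ge0//.
  by apply: le_trans (Nt _ Mk) _; rewrite ler_expR -natr1 mulrDr mulr1 addrC.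
pose q := expR (t - s).
have q1 : q < 1 by rewrite -expR0 ltr_expR subr_lt0.
apply: (@le_lt_trans _ _ (K * (1 - q)^-1)%:E); last exact: ltry.
apply: ge_ereal_sup => _ [X [finX XG] <-].
rewrite fsbig_finite// sumEFin lee_fin.
(* [B] exceeds the index of every shell that meets [X]. *)
pose B := (\max_(x <- fset_set X) (Num.truncn (word_length x)).+1)%N.
apply: (@le_trans _ _ (\sum_(x <- fset_set X) \sum_(k < B)
   (Num.truncn (word_length x) == k)%:R * expR (- (s * k%:R)))).
  rewrite big_seq_cond [leRHS]big_seq_cond; apply: ler_sum => x.
  rewrite andbT => xX.
  have xB : (Num.truncn (word_length x) < B)%N.
    rewrite /B (big_rem x)//=; exact: leq_maxl.
  rewrite (bigD1 (Ordinal xB))//= eqxx mul1r big1 ?addr0; last first.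
    by move=> k; rewrite eq_sym -val_eqE /= => /negbTE ->; rewrite mul0r.
  rewrite monomial_expR ler_expR lerN2 ler_wpM2l//.
    by rewrite ltW// (le_lt_trans _ ds).
  by rewrite truncn_le path_length_ge0.
rewrite exchange_big/=.
apply: (@le_trans _ _ (\sum_(k < B) K * q ^+ k)).
  apply: ler_sum => k _; rewrite -mulr_suml.
  have -> : q ^+ k = expR (t * k%:R) * expR (- (s * k%:R)).
    by rewrite /q -expRM_natl -expRD; congr expR; ring.
  rewrite mulrA ler_wpM2r ?expR_ge0//; apply: le_trans (NK k).
  rewrite -natr_sum ler_nat.
  have -> : (\sum_(x <- fset_set X) (Num.truncn (word_length x) == k) =
      size [seq x <- fset_set X | Num.truncn (word_length x) == k])%N.
    rewrite size_filter -sum1_count [RHS]big_mkcond.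
    by apply: eq_bigr => x _; case: (_ == _).
  rewrite orbit_countE; apply: uniq_leq_size; first by rewrite filter_uniq ?fset_uniq.
  move=> x; rewrite mem_filter !in_fset_set//; last exact: finite_word_ball.
  move=> /andP[/eqP xk /set_mem xX]; apply/mem_set; split; first exact: XG.
  by have /andP[_ /ltW] := truncn_itv (path_length_ge0 x); rewrite xk.
rewrite -(big_mkord xpredT (fun k => K * q ^+ k)).
have K0 : 0 <= K by rewrite addr_ge0 ?expR_ge0 ?ler0n.
have q1' : `|q| < 1 by rewrite ger0_norm ?expR_ge0.
exact: (geometric_le_lim B K0 (expR_gt0 (t - s)) q1').
Qed.

End Orbit.
End CriticalExponent.

(** * The bottom of the spectrum as a Dirichlet form constant *)

Section BottomSpectrum.
Variables (R : realType) (n : nat) (G : set (free_group n)) (p : 'I_n -> R).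
Hypotheses (p_ge0 : forall i, 0 <= p i) (p_half : \sum_i p i = 2^-1).
Implicit Types (f : quotient_vertex G -> R).

Lemma averagingE f : averaging p f = avg (@quotient_step n G) p f.
Proof.
apply/funext => C; rewrite /averaging /avg.
transitivity (\sum_i \sum_(b : bool) p i * f (quotient_step (i, b) C)); last first.
  by rewrite pair_big; apply: eq_bigr => -[].
apply: eq_bigr => i _; rewrite big_bool mulrDr /quotient_step /fg_gen.
by rewrite -fg_letterV.
Qed.

Lemma square_summableE f : square_summable f <-> summ (fun C => f C ^+ 2).
Proof.
rewrite /square_summable /summable /summ /tsum.
by under eq_esum do rewrite abse_EFin ger0_norm ?sqr_ge0//.
Qed.

(** Replaces the positive and negative parts in [l2_dot] by any decomposition into summable
    nonnegative functions. *)
Lemma l2_dotE (V : choiceType) (f g a b : V -> R) :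
  (forall x, f x * g x = a x - b x) -> (forall x, 0 <= a x) ->
  (forall x, 0 <= b x) -> summ a -> summ b ->
  l2_dot f g = fine (tsum a) - fine (tsum b).
Proof.
move=> fgE a0 b0 sa sb; rewrite /l2_dot.
have sE (h : V -> R) : (forall x, 0 <= h x) -> summ h -> summable setT (EFin \o h).
  move=> h0 sh; rewrite /summable.
  by under eq_esum do rewrite /= ger0_norm//.
have -> : (fun x => (f x * g x)%:E) = ((EFin \o a) \- (EFin \o b))%E.
  by apply/funext => x; rewrite fgE EFinB.
rewrite esumB//; first last.
- by move=> x _; rewrite lee_fin.
- by move=> x _; rewrite lee_fin.
- exact: sE.
- exact: sE.
by rewrite fineB ?summ_fin.
Qed.

Lemma l2_dot_sqr f : summ (fun C => f C ^+ 2) ->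
  l2_dot f f = fine (tsum (fun C => f C ^+ 2)).
Proof.
move=> sf; rewrite (@l2_dotE _ _ _ (fun C => f C ^+ 2) (fun=> 0))//.
- by rewrite [X in _ - fine X]esum1// subr0.
- by move=> C; rewrite subr0 expr2.
- by move=> C; exact: sqr_ge0.
- by rewrite /summ /tsum esum1// ltry.
Qed.

(** Pointwise, [f * Delta f] is [f^2 / 2] plus the energy density minus [A (f^2) / 2], and [f^2] and
    [A (f^2)] have the same sum. *)
Lemma l2_dot_laplacian f : summ (fun C => f C ^+ 2) ->
  (l2_dot (laplacian p f) f)%:E = energy (@quotient_step n G) p f.
Proof.
move=> sf; pose E C := \sum_(l : letter n) p l.1 / 2 *
  (f C - f (quotient_step l C)) ^+ 2.
have f20 C : 0 <= f C ^+ 2 by exact: sqr_ge0.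
have E0 C : 0 <= E C by exact: energy_term_ge0.
have A0 C : 0 <= avg (@quotient_step n G) p (fun C => f C ^+ 2) C by exact: avg_ge0.
have sA : summ (avg (@quotient_step n G) p (fun C => f C ^+ 2)).
  exact: (summ_avg (@quotient_stepK n G)).
have sE : summ E.
  apply: le_lt_trans (energy_le (@quotient_stepK n G) f p_ge0) _.
  by rewrite -(fineK (summ_fin f20 sf)) -EFinM ltry.
rewrite (@l2_dotE _ _ _ (fun C => 2^-1 * f C ^+ 2 + E C)
  (fun C => 2^-1 * avg (@quotient_step n G) p (fun C => f C ^+ 2) C)); first last.
- exact: summZ.
- by apply: summD => //; [move=> C; rewrite mulr_ge0|exact: summZ].
- by move=> C; rewrite mulr_ge0.
- by move=> C; rewrite addr_ge0// mulr_ge0.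
- move=> C; rewrite /E energy_termE// /laplacian averagingE/=.
  rewrite mulrBl -expr2; move: (avg _ _ _ _) (avg _ _ _ _) => a b.
  by move: (f C) => d; field.
rewrite tsumD//; last by move=> C; rewrite mulr_ge0.
rewrite !tsumZ// (tsum_avg (@quotient_stepK n G))// p_half mulfV// mul1e.
rewrite -(fineK (summ_fin f20 sf)) -[tsum E](fineK (summ_fin E0 sE)).
by rewrite -EFinM -EFinD /= [X in X%:E]addrAC subrr add0r fineK// summ_fin.
Qed.

Lemma energyZ (k : R) f : energy (@quotient_step n G) p (fun C => k * f C) =
  ((k ^+ 2)%:E * energy (@quotient_step n G) p f)%E.
Proof.
rewrite /energy -tsumZ ?sqr_ge0//; last by move=> C; exact: energy_term_ge0.
congr tsum; apply/funext => C; rewrite mulr_sumr; apply: eq_bigr => l _.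
by rewrite -mulrBr exprMn mulrCA.
Qed.

Lemma le_bottom_spectrum mu : gap (@quotient_step n G) p mu ->
  mu <= bottom_spectrum G p.
Proof.
move=> gp; apply: lb_le_inf.
  (* The point mass shows that the set whose infimum is taken is nonempty. *)
  pose o C : R := (C == base_vertex G)%:R.
  have oE : (fun C => o C ^+ 2) = (fun C => (1 : R) *+ (C == base_vertex G)).
    by apply/funext => C; rewrite /o; case: eqP; rewrite ?expr1n ?expr0n.
  have so : summ (fun C => o C ^+ 2) by rewrite /summ oE tsum_delta// ltry.
  exists (l2_dot (laplacian p o) o), o => //.
  split; first exact/square_summableE.
  by rewrite l2_dot_sqr// oE tsum_delta.
move=> _ [f [/square_summableE sf f1] <-].
rewrite -lee_fin l2_dot_laplacian// (le_trans _ (gp _ sf))//.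
move: f1; rewrite l2_dot_sqr// => f1.
by rewrite -(fineK (summ_fin _ sf)) ?f1 ?mule1// => C; exact: sqr_ge0.
Qed.

Lemma gap_bottom_spectrum : gap (@quotient_step n G) p (bottom_spectrum G p).
Proof.
move=> f sf; have f20 C : 0 <= f C ^+ 2 by exact: sqr_ge0.
have S := fineK (summ_fin f20 sf); rewrite -S; set s := fine _.
have s0 : 0 <= s by rewrite -lee_fin S tsum_ge0.
move: s0; rewrite le_eqVlt => /predU1P[<-|s0].
  by rewrite mule0 energy_ge0.
(* Normalising [f] to norm 1 makes it a competitor in the infimum. *)
pose k := (Num.sqrt s)^-1; have k2 : k ^+ 2 = s^-1 by rewrite exprVn sqr_sqrtr// ltW.
pose h C := k * f C.
have h2E : (fun C => h C ^+ 2) = (fun C => s^-1 * f C ^+ 2).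
  by apply/funext => C; rewrite /h exprMn k2.
have sh : summ (fun C => h C ^+ 2).
  by rewrite h2E; apply: summZ => //; rewrite invr_ge0 ltW.
have h1 : l2_dot h h = 1.
  rewrite l2_dot_sqr// h2E tsumZ ?invr_ge0 ?(ltW s0)// -S -EFinM /=.
  by rewrite mulVf// gt_eqF.
have : bottom_spectrum G p <= l2_dot (laplacian p h) h.
  apply: ge_inf; last by exists h => //; split => //; exact/square_summableE.
  exists 0 => _ [g [/square_summableE sg _] <-].
  by rewrite -lee_fin l2_dot_laplacian// energy_ge0.
rewrite -lee_fin l2_dot_laplacian// /h energyZ k2.
move=> /(lee_wpmul2l (_ : (0 <= s%:E)%E)); rewrite lee_fin => /(_ (ltW s0)).
have sV : (s%:E * (s^-1)%:E = 1)%E by rewrite -EFinM mulfV// gt_eqF.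
by rewrite muleA sV mul1e muleC.
Qed.

End BottomSpectrum.

(** * The weights p(u) and their dependence on s *)

Section PerronWeights.
Variables (R : realType) (n : nat).
Implicit Types (u : 'I_n -> R).

(** The constant [c] for which the weights [c / (u_i^-1 - u_i)] sum to 1/2. *)
Definition edge_const u : R := (2 * \sum_j ((u j)^-1 - u j)^-1)^-1.

Definition edge_weight u (i : 'I_n) : R := edge_const u / ((u i)^-1 - u i).

(** The factor [kappa] of [avg_monomial], equal to [1 - lambda(u)] by [lambda_funE]. *)
Definition perron_value u : R := edge_const u + 2 * \sum_i edge_weight u i * u i.

Hypothesis n_gt0 : (0 < n)%N.
Variable u : 'I_n -> R.
Hypothesis u01 : forall i, 0 < u i < 1.

Lemma inv_sub_gt0 i : 0 < (u i)^-1 - u i.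
Proof.
have /andP[u0 u1] := u01 i; rewrite subr_gt0 (lt_trans u1)//.
by rewrite -[1]invr1 ltf_pV2 ?posrE.
Qed.

Let w_neq0 i : (u i)^-1 - u i != 0. Proof. by rewrite gt_eqF ?inv_sub_gt0. Qed.

Lemma sum_inv_gt0 : 0 < \sum_j ((u j)^-1 - u j)^-1.
Proof.
rewrite (bigD1 (Ordinal n_gt0))//= ltr_wpDr ?invr_gt0 ?inv_sub_gt0//.
by apply: sumr_ge0 => j _; rewrite invr_ge0 ltW ?inv_sub_gt0.
Qed.

Lemma edge_const_gt0 : 0 < edge_const u.
Proof. by rewrite invr_gt0 mulr_gt0// sum_inv_gt0. Qed.

Lemma edge_weight_gt0 i : 0 < edge_weight u i.
Proof. by rewrite divr_gt0 ?edge_const_gt0 ?inv_sub_gt0. Qed.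

Lemma edge_weight_half : \sum_i edge_weight u i = 2^-1.
Proof.
rewrite -mulr_sumr /edge_const invfM -mulrA mulVf ?mulr1//.
by rewrite gt_eqF ?sum_inv_gt0.
Qed.

Lemma edge_weightE i : edge_weight u i * ((u i)^-1 - u i) = edge_const u.
Proof. by rewrite /edge_weight divfK. Qed.

Lemma perron_value_gt0 : 0 < perron_value u.
Proof.
rewrite ltr_wpDr ?edge_const_gt0// mulr_ge0// sumr_ge0// => i _.
by rewrite mulr_ge0 ?(ltW (edge_weight_gt0 i))//; have /andP[/ltW] := u01 i.
Qed.

Let W := \prod_k ((u k)^-1 - u k).

Let prodE j : \prod_(k | k != j) ((u k)^-1 - u k) = W / ((u j)^-1 - u j).
Proof. by rewrite /W [in RHS](bigD1 j)//= mulrC mulKf. Qed.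

Let W_neq0 : W != 0. Proof. by apply/prodf_neq0. Qed.

Let D_funE : D_fun u = W * \sum_j ((u j)^-1 - u j)^-1.
Proof. by rewrite /D_fun mulr_sumr; apply: eq_bigr => j _; rewrite prodE. Qed.

Lemma p_funE : p_fun u = edge_weight u.
Proof.
apply/funext => i; rewrite /p_fun prodE D_funE /edge_weight /edge_const.
have S0 : \sum_j ((u j)^-1 - u j)^-1 != 0 by rewrite gt_eqF ?sum_inv_gt0.
move: W_neq0 (w_neq0 i) S0; move: W (_ - u i) (\sum_j _) => a b d a0 b0 d0.
by field; rewrite a0 b0 d0.
Qed.

Lemma lambda_funE : lambda_fun u = 1 - perron_value u.
Proof.
have S0 : \sum_j ((u j)^-1 - u j)^-1 != 0 by rewrite gt_eqF ?sum_inv_gt0.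
rewrite /lambda_fun -/W D_funE /perron_value.
have -> : \sum_j (1 - u j) * \prod_(k | k != j) ((u k)^-1 - u k) =
   W * (\sum_j ((u j)^-1 - u j)^-1 - \sum_j u j / ((u j)^-1 - u j)).
  rewrite -sumrB mulr_sumr; apply: eq_bigr => j _; rewrite prodE; ring.
have -> : \sum_i edge_weight u i * u i =
    edge_const u * \sum_j u j / ((u j)^-1 - u j).
  by rewrite mulr_sumr; apply: eq_bigr => j _; rewrite /edge_weight; ring.
rewrite /edge_const; move: S0 (\sum_j u j / _); move: (\sum_j _) => S S0 T.
by move: W_neq0; move: W => a a0; field; rewrite a0 S0.
Qed.

(** With [p] the edge weights and [c] their constant, [1 - kappa = 2 \sum_i p_i (1 - u_i) - c]. Here
    [p_i (1 - u_i) = c u_i / (1 + u_i) >= c / 3], and two such terms suffice. *)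
Lemma perron_value_le1 : (2 <= n)%N -> (forall i, 2^-1 <= u i) -> perron_value u <= 1.
Proof.
move=> n2 u2; rewrite -subr_ge0.
have E : 1 = 2 * \sum_i edge_weight u i by rewrite edge_weight_half mulfV.
rewrite {1}E /perron_value opprD addrCA addrC subr_ge0 -mulrBr -sumrB.
have h i : edge_const u * 3^-1 <= edge_weight u i - edge_weight u i * u i.
  rewrite /edge_weight mulrAC -mulrA -mulrBr -[X in X - _]mul1r -mulrBl.
  rewrite ler_wpM2l ?(ltW edge_const_gt0)// ler_pdivlMr ?inv_sub_gt0//.
  have /andP[u0 u1] := u01 i; have := u2 i; move: (u i) u0 u1 => x x0 x1 x2.
  have x2' : x^-1 <= 2 by rewrite -[2]invrK lef_pV2 ?posrE.
  have xx : x * x^-1 = 1 by rewrite mulfV ?gt_eqF.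
  by nra.
have : \sum_(i < n) edge_const u * 3^-1 <=
    \sum_i (edge_weight u i - edge_weight u i * u i).
  by apply: ler_sum => i _; exact: h.
rewrite sumr_const card_ord -mulr_natl => H.
have n2' : 2 <= n%:R :> R by rewrite ler_nat.
by have c0 := edge_const_gt0; nra.
Qed.

End PerronWeights.

(** * Continuity of the weights and of the Perron value in [s] *)

Section Continuity.
Variables (R : realType) (n : nat) (r : 'I_n -> R).
Hypothesis n_gt0 : (0 < n)%N.
Hypothesis r_weights : weights r.

Let r_gt0 i : 0 < r i. Proof. by case: r_weights. Qed.

Lemma H_map01 s : 0 < s -> forall i, 0 < H_map r s i < 1.
Proof.
move=> s0 i; have r1 : r i < 1.
  case: r_weights => E _; apply: (@le_lt_trans _ _ 2^-1).
    by rewrite -E (bigD1 i)//= lerDl; apply: sumr_ge0 => j _; exact: ltW.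
  by rewrite invf_lt1// ltr1n.
rewrite /H_map powR_gt0//= /powR gt_eqF// -expR0 ltr_expR pmulr_rlt0//.
by rewrite ln_lt0// r_gt0.
Qed.

Lemma cvg_H_map (s0 : R) i : H_map r s i @[s --> s0] --> H_map r s0 i.
Proof.
have E s : H_map r s i = expR (s * ln (r i)) by rewrite /H_map /powR gt_eqF.
rewrite E; under eq_fun do rewrite E.
apply: continuous_cvg; first exact: continuous_expR.
by apply: cvgMr_tmp; exact: cvg_id.
Qed.

Lemma cvg_inv_sub (s0 : R) i : 0 < s0 ->
  ((H_map r s i)^-1 - H_map r s i)^-1 @[s --> s0] -->
  ((H_map r s0 i)^-1 - H_map r s0 i)^-1.
Proof.
move=> s0p; have h0 := H_map01 s0p.
apply: cvgV; first by rewrite gt_eqF// inv_sub_gt0.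
apply: cvgB; last exact: cvg_H_map.
apply: cvgV; last exact: cvg_H_map.
by rewrite gt_eqF//; have /andP[] := h0 i.
Qed.

Lemma cvg_edge_const (s0 : R) : 0 < s0 ->
  edge_const (H_map r s) @[s --> s0] --> edge_const (H_map r s0).
Proof.
move=> s0p; have h0 := H_map01 s0p.
apply: cvgV; first by rewrite gt_eqF// mulr_gt0// sum_inv_gt0.
apply: cvgMl_tmp; apply: cvg_sum_seq => i; exact: cvg_inv_sub.
Qed.

Lemma cvg_edge_weight (s0 : R) i : 0 < s0 ->
  edge_weight (H_map r s) i @[s --> s0] --> edge_weight (H_map r s0) i.
Proof.
by move=> s0p; apply: cvgM; [exact: cvg_edge_const|exact: cvg_inv_sub].
Qed.

Lemma cvg_perron_value (s0 : R) : 0 < s0 ->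
  perron_value (H_map r s) @[s --> s0] --> perron_value (H_map r s0).
Proof.
move=> s0p; apply: cvgD; first exact: cvg_edge_const.
apply: cvgMl_tmp; apply: cvg_sum_seq => i.
by apply: cvgM; [exact: cvg_edge_weight|exact: cvg_H_map].
Qed.

Lemma cvg_weight_dist (s0 : R) : 0 < s0 ->
  4 * (\sum_i `|edge_weight (H_map r s0) i - edge_weight (H_map r s) i|)
    @[s --> s0] --> (0 : R).
Proof.
move=> s0p; rewrite [X in _ --> X](_ : 0 = 4 * \sum_(i < n)
  `|edge_weight (H_map r s0) i - edge_weight (H_map r s0) i|); last first.
  by rewrite big1 ?mulr0// => i _; rewrite subrr normr0.
apply: cvgMl_tmp; apply: cvg_sum_seq => i; apply: cvg_norm.
by apply: cvgB; [exact: cvg_cst|exact: cvg_edge_weight].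
Qed.

End Continuity.

(** * Comparison with the critical exponent of the free group *)

Section FreeGroupExponent.
Variables (R : realType) (n : nat) (r : 'I_n -> R).
Hypothesis n_ge2 : (2 <= n)%N.
Hypothesis r_weights : weights r.

Let n_gt0 : (0 < n)%N. Proof. exact: ltnW. Qed.

Let r_gt0 i : 0 < r i. Proof. by case: r_weights. Qed.

Notation u := (H_map r).
Notation phi s := (monomial (H_map r s)).
Notation delta := (critical_exponent setT r).

(** * Finiteness and characterisation of the critical exponent *)

Section CriticalBounds.
Variable G : set (free_group n).
Hypothesis G1 : G 1%g.

(** The series already converges at [s = 2], because [2 \sum_i r_i^2 <= \sum_i r_i = 1/2 < 1]. *)
Lemma critical_exponent_fin :
  limf_esup (fun t : R => (ln (orbit_count G r t)%:R / t)%:E) +oo%R \is a fin_num.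
Proof.
rewrite ge0_fin_numE; last exact: limf_esup_growth_ge0.
apply: (@le_lt_trans _ _ 2%:E); last exact: ltry.
apply: limf_esup_growth_le => //.
apply: (@le_lt_trans _ _ (tsum (phi 2))).
  rewrite /poincare /tsum esum_mkcond; apply: le_esum => x _.
  by case: ifP => // _; rewrite lee_fin ltW// monomial_gt0//; apply: H_map01.
apply: summ_monomial_small; first exact: H_map01.
have [r1 _] := r_weights.
have r2 i : r i <= 2^-1.
  by rewrite -r1 (bigD1 i)//= lerDl; apply: sumr_ge0 => j _; exact: ltW.
apply: (@le_lt_trans _ _ (2 * \sum_i 2^-1 * r i)).
  rewrite ler_pM2l//; apply: ler_sum => i _.
  by rewrite /H_map powR_mulrn ?(ltW (r_gt0 i))// expr2 ler_wpM2r// ltW.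
by rewrite -mulr_sumr r1; lra.
Qed.

Lemma critical_exponent_le s : 0 <= s -> (poincare r G s < +oo)%E ->
  critical_exponent G r <= s.
Proof.
move=> s0 sfin; rewrite -lee_fin -critical_exponentE; last exact: critical_exponent_fin.
exact: limf_esup_growth_le.
Qed.

Lemma poincare_lt_pinfty s : critical_exponent G r < s -> (poincare r G s < +oo)%E.
Proof. by apply: poincare_fin => //; exact: critical_exponent_fin. Qed.

End CriticalBounds.

Lemma monomial_sqr s x : phi s x ^+ 2 = phi (s + s) x.
Proof.
by rewrite !monomial_expR// expr2 -expRD mulrDl opprD.
Qed.

(** Squaring [phi s] doubles [s], which is where the threshold [delta / 2] comes from. *)
Lemma summ_monomial_sqr s : delta / 2 < s -> summ (fun x => phi s x ^+ 2).
Proof.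
move=> ds; under eq_fun do rewrite monomial_sqr.
by apply: (@poincare_lt_pinfty setT) => //; lra.
Qed.

Lemma avg_phi s x : 0 < s ->
  avg (@tree_step n) (edge_weight (u s)) (phi s) x +
  edge_const (u s) * (x == 1%g)%:R = perron_value (u s) * phi s x.
Proof.
move=> s0; have u01 := H_map01 r_weights s0.
by apply: avg_monomial => // i; exact: edge_weightE.
Qed.

Lemma green_phi_cvg s x : 0 < s -> delta / 2 < s ->
  edge_const (u s) *
    green (@tree_step n) (edge_weight (u s)) (perron_value (u s)) 1%g N x
    @[N --> \oo] --> phi s x.
Proof.
move=> s0 ds; have u01 := H_map01 r_weights s0.
apply: cvg_green => //.
- exact: edge_const_gt0.
- exact: edge_weight_gt0.
- exact: edge_weightE.
- exact: summ_monomial_sqr.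
Qed.

Lemma summ_phi_perron s : 0 < s -> summ (phi s) -> 1 < perron_value (u s).
Proof.
move=> s0; have u01 := H_map01 r_weights s0.
apply: (summ_monomial_kappa u01 (c := edge_const (u s)) (p := edge_weight (u s))) => //.
- exact: edge_const_gt0.
- exact: edge_weight_gt0.
- exact: edge_weight_half.
- exact: edge_weightE.
Qed.

Lemma perron_summ_phi s : 0 < s -> delta / 2 < s -> 1 < perron_value (u s) ->
  summ (phi s).
Proof.
move=> s0 ds; have u01 := H_map01 r_weights s0.
move=> k1; apply: (kappa_summ_monomial u01 (c := edge_const (u s))
  (p := edge_weight (u s)) (kappa := perron_value (u s))) => //.
- exact: edge_const_gt0.
- exact: edge_weight_gt0.
- exact: edge_weight_half.
- exact: edge_weightE.
- exact: summ_monomial_sqr.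
Qed.

(** For small [s] all [u_i] are at least 1/2, so the Perron value is at most 1 and [phi s] is not
    summable. *)
Lemma delta_gt0 : 0 < delta.
Proof.
pose A := \sum_i - ln (r i).
have lr i : 0 <= - ln (r i).
  rewrite oppr_ge0 ln_le0//.
  have [r1 _] := r_weights.
  apply: (@le_trans _ _ 2^-1); last by rewrite invf_le1// ler1n.
  by rewrite -r1 (bigD1 i)//= lerDl; apply: sumr_ge0 => j _; exact: ltW.
have A0 : 0 <= A by apply: sumr_ge0.
(* Chosen so that [- s ln (r i) <= 1/2], whence [u_i >= 1 + s ln (r i) >= 1/2]. *)
pose s := (2 * (1 + A))^-1; have s0 : 0 < s by rewrite invr_gt0 mulr_gt0// ltr_pwDl.
apply: (lt_le_trans s0); rewrite leNgt; apply/negP => ds.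
have := summ_phi_perron s0 (@poincare_lt_pinfty setT I _ ds).
rewrite ltNge perron_value_le1//; first exact: H_map01.
move=> i; rewrite /H_map /powR gt_eqF//.
apply: le_trans (expR_ge1Dx _).
have Ai : - ln (r i) <= A by rewrite /A (bigD1 i)//= lerDl; exact: sumr_ge0.
have : s * - ln (r i) <= 2^-1.
  rewrite /s mulrC ler_pdivrMr ?mulr_gt0 ?ltr_pwDl// mulKf//.
  by rewrite (le_trans Ai)// lerDr.
by rewrite mulrN; lra.
Qed.

Lemma poincare_delta : ~ (poincare r setT delta < +oo)%E.
Proof.
move=> /(summ_phi_perron delta_gt0) k1; have d0 := delta_gt0.
have [e e0 eP] := near_ball (cvgr_gt _ (cvg_perron_value n_gt0 r_weights d0) _ k1).
(* Close enough to [delta] for the Perron value to exceed 1, yet above [delta / 2], so that [phi t]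
   is square summable. *)
pose t := delta - Num.min e delta / 4.
have m0 : 0 < Num.min e delta by rewrite lt_min e0.
have me : Num.min e delta <= e by rewrite ge_min lexx.
have md : Num.min e delta <= delta by rewrite ge_min lexx orbT.
have t0 : 0 < t by rewrite /t; lra.
have : summ (phi t).
  apply: perron_summ_phi => //; first by rewrite /t; lra.
  by apply: eP; rewrite /t opprB addrC subrK ger0_norm; lra.
move=> /(@critical_exponent_le setT I _ (ltW t0)).
by rewrite /t; lra.
Qed.

(** * Spectral gap of the quotient at and near the transition exponent *)

Section Gap.
Variable G : set (free_group n).
Hypothesis G_subgroup : group_closed [in G].

Let G1 : G 1%g. Proof. by apply/set_mem; case: G_subgroup. Qed.

Notation gapQ := (gap (@quotient_step n G)).

Lemma gap_perron s : 0 < s -> critical_exponent G r <= s ->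
  gapQ (edge_weight (u s)) (1 - perron_value (u s)).
Proof.
move=> s0 ds; apply: gap_closed => e e0; have u01 := H_map01 r_weights s0.
have e2 : 0 < e / 2 by rewrite divr_gt0.
have k2 : perron_value (u s) < perron_value (u s) + e / 2 by rewrite ltrDl.
have [d d0 dP] := near_ball (cvgr_lt _ (cvg_perron_value n_gt0 r_weights s0) _ k2).
have [d' d'0 d'P] := near_ball (cvgr_lt _ (cvg_weight_dist n_gt0 r_weights s0) _ e2).
(* At [t > s] the series of [G] converges; half of [e] pays for the change of Perron value, half for
   the change of weights. *)
pose t := s + Num.min d d' / 2.
have m0 : 0 < Num.min d d' by rewrite lt_min d0.
have md : Num.min d d' <= d by rewrite ge_min lexx.
have md' : Num.min d d' <= d' by rewrite ge_min lexx orbT.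
have st : `|s - t| = Num.min d d' / 2.
  by rewrite /t opprD addNKr normrN ger0_norm// divr_ge0// ltW.
have t0 : 0 < t by rewrite /t; lra.
have v01 := H_map01 r_weights t0.
have {}dP : perron_value (u t) < perron_value (u s) + e / 2.
  by apply: dP; rewrite st; lra.
have {}d'P := d'P t _; have {}d'P := d'P (_ : `|s - t| < d').
have ew0 i : 0 <= edge_weight (u s) i by rewrite ltW// edge_weight_gt0.
have ev0 i : 0 <= edge_weight (u t) i by rewrite ltW// edge_weight_gt0.
have gt : gapQ (edge_weight (u t)) (1 - perron_value (u t)).
  apply: (gap_poincare G_subgroup (phi := phi t) (c := edge_const (u t))).
  - exact/ltW/edge_const_gt0.
  - exact: edge_weight_gt0.
  - exact: edge_weight_half.
  - exact: monomial_gt0.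
  - exact/ltW/perron_value_gt0.
  - by move=> x; exact: avg_phi.
  - rewrite /coset_sum base_vertexE; apply: poincare_lt_pinfty => //.
    by rewrite /t; lra.
apply: gap_le (gap_perturb (@quotient_stepK n G) ev0 ew0 gt).
under [X in _ * X]eq_bigr do rewrite distrC.
have : 4 * (\sum_i `|edge_weight (u s) i - edge_weight (u t) i|) < e / 2.
  by apply: d'P; rewrite st; lra.
by lra.
Qed.

(** Half of the surplus of [mu] over [1 - perron_value (u s0)] survives at all [s] near [s0], so the
    Green function bounds there are uniform; they pass to [phi s] in the limit in [N]. *)
Lemma gap_strict s0 mu : 0 < s0 -> gapQ (edge_weight (u s0)) mu ->
  1 - perron_value (u s0) < mu ->
  exists K : R, exists2 e, 0 < e &
  forall s, `|s0 - s| < e -> delta / 2 < s ->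
    (forall X : {fset free_group n}, [set` X] `<=` G ->
       \sum_(x <- X) phi s x <= K) /\
    (forall X : {fset free_group n}, \sum_(x <- X) phi s x ^+ 2 <= K).
Proof.
move=> s00 g0 kmu; have u01 := H_map01 r_weights s00.
pose c := edge_const (u s0) + 1.
pose h := (mu - (1 - perron_value (u s0))) / 2.
have h0 : 0 < h by rewrite divr_gt0// subr_gt0.
have c0 : 0 < c by rewrite addr_gt0// edge_const_gt0.
(* The sum over [G] is bounded by [c / h], the sum of squares by its square; one [K] serves both. *)
exists (c / h + (c / h) ^+ 2).
have N1 : \forall s \near s0, h < mu -
    4 * (\sum_i `|edge_weight (u s0) i - edge_weight (u s) i|)
    - (1 - perron_value (u s)).
  have cv : mu - 4 * (\sum_i `|edge_weight (u s0) i - edge_weight (u s) i|)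
      - (1 - perron_value (u s)) @[s --> s0] --> mu - 0 - (1 - perron_value (u s0)).
    apply: cvgB; apply: cvgB; try exact: cvg_cst.
      exact: cvg_weight_dist.
    exact: cvg_perron_value.
  by apply: (cvgr_gt _ cv); rewrite subr0 /h; lra.
have cc : edge_const (u s0) < c by rewrite /c ltrDl.
have N2 : \forall s \near s0, edge_const (u s) < c.
  by apply: (cvgr_lt _ (cvg_edge_const n_gt0 r_weights s00)).
have [d d0 dP] := near_ball N1; have [d' d'0 d'P] := near_ball N2.
(* The minimum with [s0] keeps [s] positive. *)
exists (Num.min s0 (Num.min d d')); first by rewrite !lt_min s00 d0 d'0.
move=> s; rewrite !lt_min => /and3P[ss0 /dP{dP}hs /d'P{d'P}cs] ds.
have sp : 0 < s by move: ss0; rewrite ltr_norml => /andP[_]; lra.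
have v01 := H_map01 r_weights sp.
have ew0 i : 0 <= edge_weight (u s0) i by rewrite ltW// edge_weight_gt0.
have ev0 i : 0 <= edge_weight (u s) i by rewrite ltW// edge_weight_gt0.
have gs := gap_perturb (@quotient_stepK n G) ew0 ev0 g0.
set mu' := mu - _ in gs hs.
have kmu' : 1 - perron_value (u s) < mu' by lra.
have ci0 : 0 < edge_const (u s) by exact: edge_const_gt0.
have gb N := gap_green_coset G_subgroup N ev0 (edge_weight_half n_gt0 v01)
  (perron_value_gt0 n_gt0 v01) gs kmu'.
set g := green (@tree_step n) (edge_weight (u s)) (perron_value (u s)) 1%g in gb.
have g00 N x : 0 <= g N x.
  by apply: green_ge0 => //; exact: perron_value_gt0.
have cvg_phi x : edge_const (u s) * g N x @[N --> \oo] --> phi s x.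
  exact: green_phi_cvg.
have hV : (mu' - (1 - perron_value (u s)))^-1 <= h^-1.
  by rewrite lef_pV2 ?posrE ?(ltW hs)// subr_gt0.
have cg0 N x : 0 <= edge_const (u s) * g N x by rewrite mulr_ge0 ?(ltW ci0).
have ch0 : 0 <= c / h by rewrite divr_ge0// ltW.
split=> [X XG|X].
  have cX : \sum_(x <- X) edge_const (u s) * g N x @[N --> \oo] -->
      \sum_(x <- X) phi s x.
    exact: cvg_sum_seq.
  rewrite -(cvg_lim (@Rhausdorff R) cX); apply: limr_le; first exact: cvgP cX.
  near=> N; rewrite -mulr_sumr ler_wpDr ?sqr_ge0//.
  have [b1 _] := gb N.
  have b2 : \sum_(x <- X) g N x <= h^-1.
    apply: le_trans hV; rewrite -lee_fin; apply: le_trans b1.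
    rewrite /coset_sum base_vertexE; apply: esum_ge; exists [set` X] => //.
    by rewrite fsbig_finite// set_fsetK sumEFin.
  by apply: ler_pM => //; [exact: ltW|exact: sumr_ge0|exact: ltW].
have cX : \sum_(x <- X) (edge_const (u s) * g N x) ^+ 2 @[N --> \oo] -->
    \sum_(x <- X) phi s x ^+ 2.
  by apply: cvg_sum_seq => x; rewrite expr2; under eq_fun do rewrite expr2; exact: cvgM.
rewrite -(cvg_lim (@Rhausdorff R) cX); apply: limr_le; first exact: cvgP cX.
near=> N; rewrite ler_wpDl//.
have [_ b1] := gb N.
have b2 : \sum_(x <- X) g N x ^+ 2 <= h ^- 2.
  apply: (@le_trans _ _ ((mu' - (1 - perron_value (u s))) ^- 2)).
    rewrite -lee_fin; apply: le_trans b1.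
    by apply: (tsum_fset (f := fun x => g N x ^+ 2)) => x; exact: sqr_ge0.
  by rewrite -!exprVn ler_pXn2r// nnegrE invr_ge0 ?(ltW h0)// subr_ge0 ltW.
under eq_bigr do rewrite exprMn.
have c2 : edge_const (u s) ^+ 2 <= c ^+ 2.
  by rewrite ler_pXn2r ?nnegrE ?(ltW ci0) ?(ltW c0) ?(ltW cs).
have G0 : 0 <= \sum_(x <- X) g N x ^+ 2.
  by apply: sumr_ge0 => x _; exact: sqr_ge0.
rewrite -mulr_sumr [(c / h) ^+ 2]exprMn [h^-1 ^+ 2]exprVn.
exact: (ler_pM (sqr_ge0 _) G0 c2 b2).
Unshelve. all: by end_near.
Qed.

(** The maximum of [delta_G] and [delta / 2], written with the test used in [p_star]. *)
Definition transition_exponent : R :=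
  if delta / 2 < critical_exponent G r then critical_exponent G r else delta / 2.

Lemma gap_perron_max mu : let s0 := transition_exponent in
  gapQ (edge_weight (u s0)) mu -> mu <= 1 - perron_value (u s0).
Proof.
move=> s0 gmu; rewrite leNgt; apply/negP => kmu; have d0 := delta_gt0.
have s0_gt0 : 0 < s0 by rewrite /s0 /transition_exponent; case: ifP; lra.
have [K [e e0 eP]] := gap_strict s0_gt0 gmu kmu.
move: s0_gt0 eP; rewrite /s0 /transition_exponent; case: ifPn => [dG|_] s0_gt0 eP.
  set dg := critical_exponent G r in dG s0_gt0 eP *.
  (* Strictly below [delta_G], but still above [delta / 2] as [gap_strict] demands. *)
  pose t := dg - Num.min e (dg - delta / 2) / 2.
  have m0 : 0 < Num.min e (dg - delta / 2) by rewrite lt_min e0 subr_gt0.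
  have me : Num.min e (dg - delta / 2) <= e by rewrite ge_min lexx.
  have md : Num.min e (dg - delta / 2) <= dg - delta / 2 by rewrite ge_min lexx orbT.
  have [|| KX _] := eP t.
  - by rewrite /t opprB addrC subrK ger0_norm; lra.
  - by rewrite /t; lra.
  have : (poincare r G t < +oo)%E.
    apply: (@le_lt_trans _ _ K%:E); last exact: ltry.
    apply: ge_ereal_sup => _ [X [finX XG] <-].
    rewrite fsbig_finite// sumEFin lee_fin; apply: KX.
    by rewrite fset_setK.
  move=> /(critical_exponent_le G1 (_ : 0 <= t)).
  have t0 : 0 <= t by rewrite /t; lra.
  by move=> /(_ t0); rewrite -/dg /t; lra.
(* If [delta_G <= delta / 2], the uniform bound on sums of [phi s ^+ 2] passes to the limit from the
   right at [delta / 2], where the square is [phi delta]. *)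
apply: poincare_delta; apply: (@le_lt_trans _ _ K%:E); last exact: ltry.
apply: tsum_fset_le => X.
have -> : \sum_(x <- X) phi delta x = \sum_(x <- X) phi (delta / 2) x ^+ 2.
  by apply: eq_bigr => x _; rewrite monomial_sqr -splitr.
have cX : \sum_(x <- X) phi s x ^+ 2 @[s --> (delta / 2)^'+] -->
    \sum_(x <- X) phi (delta / 2) x ^+ 2.
  apply: cvg_sum_seq => x; apply: cvg_at_right_filter.
  have E s : phi s x ^+ 2 = expR ((s + s) * - word_length r x).
    by rewrite monomial_sqr monomial_expR// mulrN.
  rewrite E; under eq_fun do rewrite E.
  apply: continuous_cvg; first exact: continuous_expR.
  by apply: cvgMr_tmp; apply: cvgD; exact: cvg_id.
rewrite -(cvg_lim (@Rhausdorff R) cX); apply: limr_le; first exact: cvgP cX.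
near=> s.
have sd : delta / 2 < s by near: s; exact: nbhs_right_gt.
have se : s < delta / 2 + e by near: s; apply: nbhs_right_lt; rewrite ltrDl.
have [|//|_ KX] := eP s; last exact: KX.
by rewrite ltr0_norm; lra.
Unshelve. all: by end_near.
Qed.

End Gap.
End FreeGroupExponent.

(** * The bottom of the spectrum at the transition exponent *)

Theorem theorem1p4 (R : realType) (n : nat) (n_ge2 : (2 <= n)%N)
    (G : set (free_group n)) (G_subgroup : group_closed [in G])
    (r : 'I_n -> R) (r_weights : weights r) :
  bottom_spectrum G (p_star r (critical_exponent G r)) =
  if critical_exponent setT r / 2 < critical_exponent G r
  then lambda_fun (H_map r (critical_exponent G r))
  else lambda_fun (H_map r (critical_exponent setT r / 2)).
Proof.
pose s0 := transition_exponent r G.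
have d0 := delta_gt0 n_ge2 r_weights.
have n0 : (0 < n)%N by exact: ltnW.
have s0_gt0 : 0 < s0 by rewrite /s0 /transition_exponent; case: ifP; lra.
have u01 := H_map01 r_weights s0_gt0.
have p0 i : 0 <= edge_weight (H_map r s0) i by rewrite ltW// edge_weight_gt0.
have p1 := edge_weight_half n0 u01.
transitivity (1 - perron_value (H_map r s0)).
  have -> : p_star r (critical_exponent G r) = edge_weight (H_map r s0).
    by rewrite -p_funE// /p_star /s0 /transition_exponent; case: ifP.
  apply/eqP; rewrite eq_le; apply/andP; split.
    (* The bottom of the spectrum is itself a gap, hence at most the value sought; the other
       inequality holds because [s0] is at least [delta_G]. *)
    by apply: gap_perron_max => //; exact: gap_bottom_spectrum.
  apply: le_bottom_spectrum => //; apply: gap_perron => //.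
  by rewrite /s0 /transition_exponent; case: ltP.
by rewrite -lambda_funE// /s0 /transition_exponent; case: ifP.
Qed.
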